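(* Let $(P_t)_{t\ge0}$ be the transition semigroup of a reversible Markov process and $(\hat P_t)_{t\ge0}$ the transition semigroup of an arbitrary second-order lift of it. Then $$t_{\mathrm{rel}}(\hat P)\ \ge\ \frac{1-e^{-1}}{\sqrt2}\,\sqrt{t_{\mathrm{rel}}(P)}.$$ In particular, if $n\ge2$ and $(\hat P_t)_{t\ge0}$ is the transition semigroup on $L^2(\hat\mu)$ of the joint process $(\mathcal L(t),X(t))_{t\ge0}$ of the centred local time profile and the position of the self-repellent random walk on $\mathbb Z_n$, then $$t_{\mathrm{rel}}(\hat P)\ \ge\ \frac{1-e^{-1}}{2\pi}\,n^{3/2}.$$
   Context: Second-order lifts. Let $(P_t)$ be the strongly continuous contraction semigroup on $L^2(\mu)$ of a Markov process on a state space $\mathcal S$ that is reversible with respect to the probability measure $\mu$, with generator $(\mathfrak L,\mathrm{Dom}(\mathfrak L))$. Let $(\hat P_t)$ be the strongly continuous contraction semigroup on $L^2(\hat\mu)$ of a Markov process on a product space $\mathcal S\times\mathcal V$ with invariant probability measure $\hat\mu=\mu\otimes\kappa$, with generator $(\hat{\mathfrak L},\mathrm{Dom}(\hat{\mathfrak L}))$, and let $\pi(\ell,x)=\ell$. The latter is a second-order lift of the former if there is a core $C$ of $(\mathfrak L,\mathrm{Dom}(\mathfrak L))$ such that $f\circ\pi\in\mathrm{Dom}(\hat{\mathfrak L})$ for all $f\in C$ and, for all $f,g\in C$, $\langle\hat{\mathfrak L}(f\circ\pi),g\circ\pi\rangle_{L^2(\hat\mu)}=0$ and $\frac12\langle\hat{\mathfrak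 L}(f\circ\pi),\hat{\mathfrak L}(g\circ\pi)\rangle_{L^2(\hat\mu)}=-\langle f,\mathfrak Lg\rangle_{L^2(\mu)}$. Relaxation time. $t_{\mathrm{rel}}(\hat P)=\inf\{t\ge0:\|\hat P_tf\|_{L^2(\hat\mu)}\le e^{-1}\|f\|_{L^2(\hat\mu)}\text{ for all }f\in L_0^2(\hat\mu)\}$, where $L_0^2(\hat\mu)$ is the orthogonal complement of the constants in $L^2(\hat\mu)$ (with $\inf\emptyset=\infty$); $t_{\mathrm{rel}}(P)$ is defined in the same way with $P,\mu$ in place of $\hat P,\hat\mu$. Self-repellent random walk. $\mathbb Z_n=\mathbb Z/n\mathbb Z$ with periodic indices; $(a)_+=\max(a,0)$, $(a)_-=\max(-a,0)$; $l_i'=l_{i+1}-l_i$; $\mathcal S=\{\ell\in\mathbb R^n:\sum_i\ell_i=0\}$; $\mathbf 1=(1,\dots,1)^\top$; $\partial_{\ell_i}$ is the directional derivative on $\mathcal S$ in direction $e_i-n^{-1}\mathbf 1$. $X(t)$ is a continuous-time process on $\mathbb Z_n$ with local time $L_i(t)=\int_0^t1_{\{i\}}(X(s))\,\mathrm ds$, jumping $i\to i+1$ with rate $(l_i')_-$ and $i\to i-1$ with rate $(l_{i-1}')_+$, where $l$ is the current value of $L(t)$; $\mathcal L_i(t)=L_i(t)-t/n$. Then $(\mathcal L(t),X(t))$ is a piecewise deterministic Markov process on $\mathcal S\times\mathbb Z_n$ (considered for arbitrary initial states) with generator on $f\in C_b^1(\mathcal S\times\mathbb Z_n)$ given by $$\hat{\mathfrak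 L}f(\ell,i)=\partial_{\ell_i}f(\ell,i)+(\ell_i')_-\big(f(\ell,i+1)-f(\ell,i)\big)+(\ell_{i-1}')_+\big(f(\ell,i-1)-f(\ell,i)\big).$$ Its invariant probability measure is $\hat\mu=\mu\otimes\mathrm{Unif}(\mathbb Z_n)$, where $\mu=\mathcal N(0,-\Delta_n^{-1})$ is the Gaussian measure on $\mathcal S$ with density proportional to $\exp(-\frac12\sum_i(\ell_{i+1}-\ell_i)^2)$ and $(\Delta_nl)_i=l_{i+1}-2l_i+l_{i-1}$. $(\hat P_t)$ is the induced strongly continuous contraction semigroup on $L^2(\hat\mu)$. *)

(* Defs.v *)
From HB Require Import structures.
From mathcomp Require Import all_boot all_order all_algebra.
From mathcomp Require Import all_classical all_reals all_analysis.
Set Implicit Arguments.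
Unset Strict Implicit.
Unset Printing Implicit Defensive.
Import Order.TTheory GRing.Theory Num.Theory.
Import numFieldNormedType.Exports.
Local Open Scope classical_set_scope.
Local Open Scope ring_scope.

(** * Markov semigroups on L^2

    Elements of L^2(m) are represented by functions in [Lfun m 2%:E].
    When [m] is invariant, changing [f] on an m-null set changes
    [semigroup p t f] on an m-null set only. *)

Section L2.
Context d (T : measurableType d) (R : realType).
Variable m : {measure set T -> \bar R}.

Definition L2 : set (T -> R) := [set f | f \in Lfun m 2%:E].

Definition L2norm (f : T -> R) : \bar R := Lnorm m 2%:E (EFin \o f).

Definition L2inner (f g : T -> R) : R := \int[m]_x (f x * g x).

Definition L20 : set (T -> R) :=
  [set f | L2 f /\ forall c : R, L2inner f (cst c) = 0].

End L2.

Section markov.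
Context d (T : measurableType d) (R : realType).
Variables (m : {measure set T -> \bar R}) (p : R -> R.-pker T ~> T).

(* Only nonnegative times matter: [p t] is unconstrained for [t < 0]. *)
Definition transition_function : Prop :=
  (forall x A, measurable A -> p 0 x A = \d_x A) /\
  (forall s t, 0 <= s -> 0 <= t -> forall x A, measurable A ->
     p (s + t) x A = (\int[p s x]_y p t y A)%E).

Definition invariant_measure : Prop :=
  forall t, 0 <= t -> forall A, measurable A -> (\int[m]_x p t x A)%E = m A.

Definition reversible_measure : Prop :=
  forall t, 0 <= t -> forall A B, measurable A -> measurable B ->
    (\int[m]_(x in A) p t x B)%E = (\int[m]_(x in B) p t x A)%E.

Definition semigroup (t : R) (f : T -> R) : T -> R :=
  fun x => \int[p t x]_y f y.

Definition strongly_continuous : Prop :=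
  forall f, L2 m f -> L2norm m (semigroup t f \- f) @[t --> 0^'+] --> 0%E.

(* Graph of the L^2 generator: [f] is in its domain and is mapped to [g]. *)
Definition L2_generator (f g : T -> R) : Prop :=
  [/\ L2 m f, L2 m g &
      L2norm m (fun x => t^-1 * (semigroup t f x - f x) - g x)
        @[t --> 0^'+] --> 0%E].

Definition generator_core (C : set (T -> R)) : Prop :=
  [/\ C (cst 0) /\
        (forall (a : R) f g, C f -> C g -> C (fun x => a * f x + g x)),
      forall f, C f -> exists g, L2_generator f g &
      forall f g, L2_generator f g -> forall e : R, 0 < e ->
        exists f' g', [/\ C f', L2_generator f' g',
          (L2norm m (f' \- f)%R < e%:E)%E & (L2norm m (g' \- g)%R < e%:E)%E]].

Definition relaxation_time : \bar R :=
  ereal_inf [set t%:E | t in [set t : R | 0 <= t /\ forall f, L20 m f ->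
    (L2norm m (semigroup t f) <= (expR (-1))%:E * L2norm m f)%E]].

End markov.

Definition second_order_lift dS dV (S : measurableType dS)
    (V : measurableType dV) (R : realType)
    (mu : probability S R) (kappa : probability V R)
    (p : R -> R.-pker S ~> S)
    (ph : R -> R.-pker (S * V)%type ~> (S * V)%type) : Prop :=
  let muh := (mu \x kappa)%E in
  exists C : set (S -> R), [/\ generator_core mu p C,
    forall f, C f -> exists F, L2_generator muh ph (f \o fst) F &
    forall f g Lg F G, C f -> C g -> L2_generator mu p g Lg ->
      L2_generator muh ph (f \o fst) F -> L2_generator muh ph (g \o fst) G ->
      L2inner muh F (g \o fst) = 0 /\
      2^-1 * L2inner muh F G = - L2inner mu f Lg].

(** * Centred profiles

    A vector indexed by Z_n is a row vector of size [(Zp_trunc n).+2], since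
    ['Z_n] is ['I_(Zp_trunc n).+2]. This is R^n for [1 < n] only. *)

HB.instance Definition _ (n : nat) := isPointed.Build 'I_n.+1 ord0.
HB.instance Definition _ (n : nat) := @isMeasurable.Build
  default_measure_display 'I_n.+1 discrete_measurable discrete_measurable0
  discrete_measurableC discrete_measurableU.

Definition centred (R : realType) (n : nat) : {pred 'rV[R]_(Zp_trunc n).+2} :=
  [pred l : 'rV[R]_(Zp_trunc n).+2 | \sum_(i : 'Z_n) l ord0 i == 0].

Lemma centred_submod (R : realType) (n : nat) :
  submod_closed (@centred R n).
Proof.
split=> [|a u v]; rewrite !inE.
  by apply/eqP; rewrite big1 // => i _; rewrite mxE.
move=> /eqP u0 /eqP v0; apply/eqP.
rewrite (eq_bigr (fun i => a * u ord0 i + v ord0 i)); last first.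
  by move=> i _; rewrite !mxE.
by rewrite big_split /= -mulr_sumr u0 v0 mulr0 addr0.
Qed.

HB.instance Definition _ (R : realType) (n : nat) :=
  GRing.isSubmodClosed.Build R 'rV[R]_(Zp_trunc n).+2 (@centred R n)
    (@centred_submod R n).

Record profile (R : realType) (n : nat) :=
  Profile { pval : 'rV[R]_(Zp_trunc n).+2 ; _ : pval \in @centred R n }.

HB.instance Definition _ (R : realType) (n : nat) :=
  [isSub for @pval R n].
HB.instance Definition _ (R : realType) (n : nat) :=
  [Choice of profile R n by <:].
HB.instance Definition _ (R : realType) (n : nat) :=
  [SubChoice_isSubLmodule of profile R n by <:].
HB.instance Definition _ (R : realType) (n : nat) :=
  isPointed.Build (profile R n) 0.

Definition profile_coord (R : realType) (n : nat) (i : 'Z_n)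
    (l : profile R n) : R :=
  pval l ord0 i.

Section measurable_profile.
Variables (R : realType) (n : nat).

Let coords : 'Z_n -> profile R n -> measurableTypeR R := @profile_coord R n.

Let profile0 : g_sigma_preimage coords set0.
Proof. exact: sigma_algebra0. Qed.

Let profileC A : g_sigma_preimage coords A -> g_sigma_preimage coords (~` A).
Proof. exact: sigma_algebraC. Qed.

Let profileU (F : (set (profile R n))^nat) :
  (forall i, g_sigma_preimage coords (F i)) ->
  g_sigma_preimage coords (\bigcup_i (F i)).
Proof. exact: sigma_algebra_bigcup. Qed.

HB.instance Definition _ := @isMeasurable.Build default_measure_display
  (profile R n) (g_sigma_preimage coords) profile0 profileC profileU.

End measurable_profile.

Section profile.
Variables (R : realType) (n : nat).
Implicit Types (l : profile R n) (i j : 'Z_n).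

(* Discrete derivative l'_i = l_(i+1) - l_i. *)
Definition slope l i : R := profile_coord (i + 1) l - profile_coord i l.

Definition centred_delta_mx i : 'rV[R]_(Zp_trunc n).+2 :=
  \row_(j < _) ((j == i)%:R - #|'Z_n|%:R^-1).

Lemma centred_delta_subproof i : centred_delta_mx i \in @centred R n.
Proof.
rewrite inE; apply/eqP.
have n0 : #|'Z_n|%:R != 0 :> R by rewrite card_ord pnatr_eq0.
under eq_bigr do rewrite mxE.
rewrite sumrB sumr_const (bigD1 i) //= eqxx big1 ?addr0.
  by rewrite -[X in _ - X]mulr_natr mulVf // subrr.
by move=> j /negPf ->.
Qed.

(* The vector e_i - n^-1 1. *)
Definition centred_delta i : profile R n := Profile (centred_delta_subproof i).

Definition directional (g : profile R n -> R) i l : R :=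
  derive1 (fun t : R => g (l + t *: centred_delta i)) 0.

(* Lebesgue measure on the hyperplane, determined up to a constant factor as a
   translation-invariant measure that is finite on bounded sets. *)
Definition lebesgue_hyperplane (lam : {measure set (profile R n) -> \bar R}) :
    Prop :=
  (forall (h : profile R n) (A : set (profile R n)), measurable A ->
     lam [set l : profile R n | A (l + h)] = lam A) /\
  (forall b : R, (lam [set l | forall i, `|profile_coord i l| <= b]%R < +oo)%E).

Definition energy l : R := \sum_i slope l i ^+ 2.

(* The Gaussian measure N(0, - Delta_n^-1). *)
Definition gaussian_profile (mu : {measure set (profile R n) -> \bar R}) :
    Prop :=
  exists (lam : {measure set (profile R n) -> \bar R}) (Z : R),
    [/\ lebesgue_hyperplane lam, 0 < Z &
      forall A, measurable A ->
        mu A = (\int[lam]_(l in A) (expR (- 2^-1 * energy l) / Z)%:E)%E].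

Definition uniform_Zn (kappa : {measure set 'Z_n -> \bar R}) : Prop :=
  forall i, kappa [set i] = (n%:R^-1)%:E.

(** * The self-repellent random walk *)

Definition rate_right l i : R := Num.max (- slope l i) 0.
Definition rate_left l i : R := Num.max (slope l (i - 1)) 0.

Definition srrw_generator (f : profile R n * 'Z_n -> R) :
    profile R n * 'Z_n -> R :=
  fun x => let: (l, i) := x in
    directional (fun l' => f (l', i)) i l
    + rate_right l i * (f (l, i + 1) - f (l, i))
    + rate_left l i * (f (l, i - 1) - f (l, i)).

Definition continuous_profile (g : profile R n -> R) : Prop :=
  continuous (g : initial_topology (@pval R n) -> R).

Definition C1b (f : profile R n * 'Z_n -> R) : Prop :=
  (exists b : R, forall x, `|f x| <= b) /\
  forall i, continuous_profile (fun l => f (l, i)) /\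
    forall j,
      [/\ forall l,
            derivable (fun t : R => f (l + t *: centred_delta j, i)) 0 1,
          continuous_profile (directional (fun l => f (l, i)) j) &
          exists b : R, forall l, `|directional (fun l => f (l, i)) j l| <= b].

End profile.

Section process.
Context d (Om : measurableType d) (R : realType).

Definition past dT (T : measurableType dT) (Y : R -> Om -> T) (t : R) :
    set (set Om) :=
  <<s [set A | exists (s : R) B,
         [/\ 0 <= s <= t, measurable B & A = Y s @^-1` B]] >>.

Definition martingale (P : probability Om R) (F : R -> set (set Om))
    (M : R -> Om -> R) : Prop :=
  (forall t : R, 0 <= t -> P.-integrable setT (EFin \o M t) /\
     forall B, measurable B -> F t (M t @^-1` B)) /\
  (forall s t : R, 0 <= s <= t -> forall A, F s A ->
     \int[P]_(w in A) M t w = \int[P]_(w in A) M s w).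

Definition local_time (n : nat) (X : R -> Om -> 'Z_n) (i : 'Z_n) (t : R)
    (w : Om) : R :=
  \int[@lebesgue_measure R]_(s in `[0, t]) \1_[set i] (X s w).

(* The family of processes (cL, X), under [P x] for each initial state [x].
   The jump rates of the walk enter through the martingale problem for the
   generator on C_b^1, which determines the law under each [P x]; the Markov
   property and the invariant measure are consequences. *)
Record srrw (n : nat) (P : profile R n * 'Z_n -> probability Om R)
    (cL : R -> Om -> profile R n) (X : R -> Om -> 'Z_n) : Prop := {
  srrw_measurable : forall t, 0 <= t ->
    measurable_fun setT (cL t) /\ measurable_fun setT (X t) ;
  srrw_right_cont : forall w t, 0 <= t ->
    exists2 e : R, 0 < e & forall s, t <= s < t + e -> X s w = X t w ;
  srrw_left_lim : forall w t, 0 < t ->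
    exists i, exists2 e : R, 0 < e & forall s, 0 <= s -> t - e < s < t ->
      X s w = i ;
  srrw_start : forall x, {ae P x, forall w, (cL 0 w, X 0 w) = x} ;
  srrw_local_time : forall w t i, 0 <= t ->
    profile_coord i (cL t w) =
      profile_coord i (cL 0 w) + local_time X i t w - t / n%:R ;
  srrw_martingale : forall x f, C1b f ->
    martingale (P x) (past (fun s w => (cL s w, X s w)))
      (fun t w => f (cL t w, X t w) - f (cL 0 w, X 0 w)
         - \int[@lebesgue_measure R]_(s in `[0, t])
             srrw_generator f (cL s w, X s w)) }.

(* [p] gives the laws of [Y] under [P x] for each initial state [x]. *)
Definition transition_of dT (T : measurableType dT) (P : T -> probability Om R)
    (Y : R -> Om -> T) (p : R -> R.-pker T ~> T) : Prop :=
  forall t, 0 <= t -> forall x A, measurable A -> p t x A = P x (Y t @^-1` A).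

End process.

(* Main.v *)
(** Lower bounds on the relaxation time of a lift come from short-time
    behaviour: if [F] is the lifted generator at [f o pi], then
    [|f o pi - Ph_t (f o pi)| <= t |F|] with [|F|^2 = - 2 <f, L f>].  If [Ph_t]
    contracts mean-zero functions by [e^-1], the left-hand side is at least
    [(1 - e^-1) |f - mean f|], which is a Poincare inequality with constant
    [K = 2 t^2 / (1 - e^-1)^2] on the core, hence on the whole domain, and the
    Poincare inequality gives [|P_K f| <= e^-1 |f|] on mean-zero functions.

    For the self-repellent walk the argument is pathwise.  Let [c] be an
    eigenvector of the discrete Laplacian for its lowest nonzero eigenvalue,
    [|c_i| <= 1], and [G(l) = sum_i c_i l_i].  The local times at time [t] sum
    to [t], so [G] moves by at most [t] up to time [t].  A centred function of
    the sign of [G] is thus left unchanged by [Ph_t] where [|G| > t].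
    Translating the Gaussian measure in the direction [c] shows that this set
    carries a fraction larger than [e^-2] of the squared norm of that function
    whenever [t < (1 - e^-1) n^(3/2) / (2 pi)]. *)

Require Import Defs.
From HB Require Import structures.
From mathcomp Require Import all_boot all_order all_algebra.
From mathcomp Require Import all_classical all_reals all_analysis.
From mathcomp Require Import measurable_realfun ring lra.
Set Implicit Arguments.
Unset Strict Implicit.
Unset Printing Implicit Defensive.
Import Order.TTheory GRing.Theory Num.Theory.
Import numFieldNormedType.Exports.
Local Open Scope classical_set_scope.
Local Open Scope ring_scope.

(** * Semi-inner product spaces *)

(** The Poincare constant [K] bounds the relaxation time itself because [d/ds |P_s f|^2 = 2 <P_s f,
    L P_s f> <= - (2/K) |P_s f|^2], so [|P_K f|^2 <= e^-2 |f|^2]. This makes sense on the domain of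
    the generator only; other [f] are reached by density, through the averages
    [h^-1 int_0^h P_s f ds]. Elements of L^2 are genuine functions here, so the inner product has a
    kernel and the semigroup laws hold up to null functions. The functional analysis is therefore
    done in an abstract space with a semi-inner product, with finite differences in place of
    derivatives and Riemann sums in place of vector-valued integrals. For the walk, [G] has variance
    [|c|^2 / lambda] under the Gaussian measure, with [|c|^2 >= n/2] and [lambda <= 4 pi^2 / n^2];
    its standard deviation is thus at least [n^(3/2) / (2 sqrt 2 pi)]. Since [(1 - e^-1)^2 < 1/2],
    the claimed time lies below this. As [G] moves at speed at most one, no shorter time can forget
    its sign. *)

Section semi_inner_product.
Variables (R : realType) (V : lmodType R).

Definition semi_inner (ip : V -> V -> R) : Prop :=
  [/\ forall u v, ip u v = ip v u,
      forall a u v w, ip (a *: u + v) w = a * ip u w + ip v w &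
      forall u, 0 <= ip u u].

Variable ip : V -> V -> R.
Hypothesis ipP : semi_inner ip.

Definition nrm (u : V) : R := Num.sqrt (ip u u).

Lemma ipC u v : ip u v = ip v u. Proof. by case: ipP. Qed.

Lemma ip_ge0 u : 0 <= ip u u. Proof. by case: ipP. Qed.

Lemma ipDl u v w : ip (u + v) w = ip u w + ip v w.
Proof. by case: ipP => _ h _; rewrite -[u]scale1r h mul1r scale1r. Qed.

Lemma ip0l w : ip 0 w = 0.
Proof. by apply: (addrI (ip 0 w)); rewrite -ipDl !addr0. Qed.

Lemma ipZl a u w : ip (a *: u) w = a * ip u w.
Proof. by case: ipP => _ h _; rewrite -[a *: u]addr0 h ip0l addr0. Qed.

Lemma ipNl u w : ip (- u) w = - ip u w.
Proof. by rewrite -scaleN1r ipZl mulN1r. Qed.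

Lemma ipBl u v w : ip (u - v) w = ip u w - ip v w.
Proof. by rewrite ipDl ipNl. Qed.

Lemma ipDr u v w : ip w (u + v) = ip w u + ip w v.
Proof. by rewrite !(ipC w) ipDl. Qed.

Lemma ipZr a u w : ip w (a *: u) = a * ip w u.
Proof. by rewrite !(ipC w) ipZl. Qed.

Lemma ipBr u v w : ip w (u - v) = ip w u - ip w v.
Proof. by rewrite !(ipC w) ipBl. Qed.

Lemma nrm_ge0 u : 0 <= nrm u. Proof. exact: sqrtr_ge0. Qed.

Lemma nrm_sq u : nrm u ^+ 2 = ip u u.
Proof. by rewrite sqr_sqrtr ?ip_ge0. Qed.

Lemma nrm_sqD u v :
  nrm (u + v) ^+ 2 = nrm u ^+ 2 + 2 * ip u v + nrm v ^+ 2.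
Proof. by rewrite !nrm_sq ipDl !ipDr (ipC v u); ring. Qed.

Lemma nrm0 : nrm 0 = 0. Proof. by rewrite /nrm ip0l sqrtr0. Qed.

Lemma nrmZ a u : nrm (a *: u) = `|a| * nrm u.
Proof.
by rewrite /nrm ipZl ipZr mulrA -expr2 sqrtrM ?sqr_ge0 // sqrtr_sqr.
Qed.

Lemma nrmN u : nrm (- u) = nrm u.
Proof. by rewrite -scaleN1r nrmZ normrN1 mul1r. Qed.

Lemma nrmB u v : nrm (u - v) = nrm (v - u).
Proof. by rewrite -nrmN opprB. Qed.

Lemma cauchy_schwarz u v : `|ip u v| <= nrm u * nrm v.
Proof.
rewrite -(@ler_pXn2r _ 2) ?nnegrE ?mulr_ge0 ?nrm_ge0 //.
rewrite real_normK ?num_real // exprMn !nrm_sq.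
have [v0|v0] := eqVneq (ip v v) 0.
  (* The form may be degenerate. If [|v| = 0], then [|u + (a/2) v|^2 = <u,u> + a <u,v>] is affine in
     [a] and nonnegative, which forces [<u,v> = 0]; the value of [a] used below would make it -1. *)
  rewrite v0 mulr0; have h : forall a, 0 <= ip u u + a * ip u v.
    move=> a; have := ip_ge0 (u + (a / 2) *: v).
    rewrite ipDl !ipDr !ipZl !ipZr v0 (ipC v u) => h; lra.
  have [uv0|uv0] := eqVneq (ip u v) 0; first by rewrite uv0 expr0n.
  have := h (- (ip u u + 1) / ip u v); rewrite divfK // => ?; lra.
have := ip_ge0 (ip v v *: u - ip u v *: v).
rewrite ipBl !ipBr !ipZl !ipZr (ipC v u) => h.
have vpos : 0 < ip v v by rewrite lt0r v0 ip_ge0.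
rewrite -(ler_pM2l vpos); lra.
Qed.

Lemma ip_le u v : ip u v <= nrm u * nrm v.
Proof. exact: le_trans (ler_norm _) (cauchy_schwarz u v). Qed.

Lemma nrmD u v : nrm (u + v) <= nrm u + nrm v.
Proof.
rewrite -(@ler_pXn2r _ 2) ?nnegrE ?addr_ge0 ?nrm_ge0 //.
rewrite nrm_sqD; have := ip_le u v; lra.
Qed.

Lemma nrm_triangle w u v : nrm (u - v) <= nrm (u - w) + nrm (w - v).
Proof. by have := nrmD (u - w) (w - v); rewrite addrA subrK. Qed.

Lemma nrm_sum (I : Type) (s : seq I) (Q : pred I) (F : I -> V) :
  nrm (\sum_(i <- s | Q i) F i) <= \sum_(i <- s | Q i) nrm (F i).
Proof.
elim/big_rec2: _ => [|i y x _ h]; first by rewrite nrm0.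
by apply: le_trans (nrmD _ _) _; rewrite lerD2l.
Qed.

(* Markov operators on genuine functions are linear only up to null sets, so the
   axioms of a semigroup are stated modulo [eqv]. *)
Definition eqv (u v : V) : Prop := nrm (u - v) = 0.

Lemma eqv_of_nrm_le0 u v : nrm (u - v) <= 0 -> eqv u v.
Proof. by move=> h; apply/eqP; rewrite eq_le h nrm_ge0. Qed.

Lemma eqv_refl u : eqv u u. Proof. by rewrite /eqv subrr nrm0. Qed.

Lemma eqv_sym u v : eqv u v -> eqv v u. Proof. by rewrite /eqv nrmB. Qed.

Lemma eqv_trans w u v : eqv u w -> eqv w v -> eqv u v.
Proof.
move=> uw wv; apply: eqv_of_nrm_le0.
by apply: le_trans (nrm_triangle w _ _) _; rewrite uw wv addr0.
Qed.

Lemma eqvD u v u' v' : eqv u u' -> eqv v v' -> eqv (u + v) (u' + v').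
Proof.
move=> h1 h2; apply: eqv_of_nrm_le0.
by rewrite opprD addrACA; apply: le_trans (nrmD _ _) _; rewrite h1 h2 addr0.
Qed.

Lemma eqvZ a u v : eqv u v -> eqv (a *: u) (a *: v).
Proof. by move=> h; rewrite /eqv -scalerBr nrmZ h mulr0. Qed.

Lemma eqvN u v : eqv u v -> eqv (- u) (- v).
Proof. by move=> h; rewrite /eqv -opprD nrmN. Qed.

Lemma eqvB u v u' v' : eqv u u' -> eqv v v' -> eqv (u - v) (u' - v').
Proof. by move=> h1 /eqvN; exact: eqvD. Qed.

Lemma eqv_sum (I : Type) (s : seq I) (Q : pred I) (F G : I -> V) :
  (forall i, Q i -> eqv (F i) (G i)) ->
  eqv (\sum_(i <- s | Q i) F i) (\sum_(i <- s | Q i) G i).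
Proof.
move=> h; elim/big_rec2: _ => [|i y x Qi]; first exact: eqv_refl.
by move=> xy; apply: eqvD => //; exact: h.
Qed.

Lemma eqv_nrm u v : eqv u v -> nrm u = nrm v.
Proof.
move=> uv; have vu := eqv_sym uv; apply/eqP; rewrite eq_le.
have := nrmD (u - v) v; have := nrmD (v - u) u.
by rewrite uv vu !add0r !subrK => -> ->.
Qed.

End semi_inner_product.
(** * Contraction semigroups *)

(** The restriction to [e <= 1] lets quadratic error terms be absorbed into [e * c]. *)
Lemma ler_eps (R : realFieldType) (x y c : R) : 0 <= c ->
  (forall e, 0 < e -> e <= 1 -> x <= y + e * c) -> x <= y.
Proof.
move=> c0 h; apply/ler_addgt0Pr => e e0.
have c1 : 0 < c + 1 by rewrite ltr_wpDl.
have e'0 : 0 < Num.min 1 (e / (c + 1)) by rewrite lt_min ltr01 divr_gt0.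
apply: le_trans (h _ e'0 _) _; first by rewrite ge_min lexx.
rewrite lerD2l; apply: (@le_trans _ _ (e / (c + 1) * c)).
  by rewrite ler_wpM2r // ge_min lexx orbT.
by rewrite mulrAC ler_pdivrMr // ler_pM2l // lerDl.
Qed.

Section contraction_semigroup.
Variables (R : realType) (V : lmodType R) (ip : V -> V -> R).
Local Notation N := (nrm ip).
Local Notation "u ~ v" := (eqv ip u v) (at level 70).

Record contraction_semigroup (P : R -> V -> V) : Prop := {
  csg0 : forall f, P 0 f ~ f ;
  csgD : forall (s t : R) f, 0 <= s -> 0 <= t -> P s (P t f) ~ P (s + t) f ;
  csg_linear : forall (t : R) a f g, 0 <= t ->
    P t (a *: f + g) ~ a *: P t f + P t g ;
  csg_le : forall (t : R) f, 0 <= t -> N (P t f) <= N f ;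
  csg_cont : forall f (e : R), 0 < e ->
    exists2 d : R, 0 < d & forall t : R, 0 <= t < d -> N (P t f - f) <= e }.

Variable P : R -> V -> V.

(** The difference quotient is multiplied out by [t]. This is a relation because [f] determines [g]
    only up to [eqv]. *)
Definition generator (f g : V) : Prop :=
  forall e : R, 0 < e -> exists2 d : R, 0 < d &
    forall t : R, 0 < t < d -> N (P t f - f - t *: g) <= e * t.

Hypotheses (ipP : semi_inner ip) (PP : contraction_semigroup P).

Let erefl u : u ~ u := eqv_refl ipP u.
Let esym u v : u ~ v -> v ~ u := @eqv_sym _ _ _ ipP u v.
Let etrans w u v : u ~ w -> w ~ v -> u ~ v := @eqv_trans _ _ _ ipP w u v.

Lemma csgB (s : R) f g : 0 <= s -> P s (f - g) ~ P s f - P s g.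
Proof.
move=> s0; have := csg_linear PP (-1) g f s0.
by rewrite !scaleN1r (addrC _ f) (addrC _ (P s f)).
Qed.

Lemma csg_zero (s : R) : 0 <= s -> P s 0 ~ 0.
Proof.
by move=> s0; apply: eqv_of_nrm_le0; rewrite subr0 -(nrm0 ipP); exact: csg_le.
Qed.

Lemma csgZ (s a : R) f : 0 <= s -> P s (a *: f) ~ a *: P s f.
Proof.
move=> s0; rewrite -[a *: f]addr0 -[a *: P s f]addr0.
apply: etrans (csg_linear PP a f 0 s0) _.
by apply: eqvD => //; exact: csg_zero.
Qed.

Lemma csg_add (s : R) f g : 0 <= s -> P s (f + g) ~ P s f + P s g.
Proof.
by move=> s0; have := csg_linear PP 1 f g s0; rewrite !scale1r.
Qed.

Lemma csg_dist (s : R) f g : 0 <= s -> N (P s f - P s g) <= N (f - g).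
Proof.
by move=> s0; rewrite -(eqv_nrm ipP (csgB f g s0)); exact: csg_le.
Qed.

Lemma csg_sum (s : R) (I : Type) (r : seq I) (Q : pred I) (F : I -> V) :
  0 <= s ->
  P s (\sum_(i <- r | Q i) F i) ~ \sum_(i <- r | Q i) P s (F i).
Proof.
move=> s0; elim/big_rec2: _ => [|i y x _ h]; first exact: csg_zero.
by apply: etrans (csg_add _ _ s0) _; apply: eqvD.
Qed.

Lemma csg_incr (s h : R) f : 0 <= s -> 0 <= h ->
  N (P (s + h) f - P s f) <= N (P h f - f).
Proof.
move=> s0 h0; have e := esym (csgD PP f s0 h0).
by rewrite (eqv_nrm ipP (eqvB ipP e (erefl (P s f)))); exact: csg_dist.
Qed.

Lemma csg_incr_mul (h : R) f (n : nat) : 0 <= h ->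
  N (P (n%:R * h) f - f) <= n%:R * N (P h f - f).
Proof.
move=> h0; elim: n => [|n IH]; first by rewrite !mul0r (csg0 PP).
have nh : 0 <= n%:R * h by rewrite mulr_ge0.
apply: le_trans (nrm_triangle ipP (P (n%:R * h) f) _ _) _.
rewrite -natr1 !mulrDl !mul1r addrC lerD //.
exact: csg_incr.
Qed.

(** Stands in for [|int_0^t P_s g ds| <= t |g|]: [t] is cut into equal steps shorter than [d], and
    by contraction no increment exceeds the first one. *)
Lemma generator_le (t : R) f g : 0 <= t -> generator f g ->
  N (P t f - f) <= t * N g.
Proof.
rewrite le_eqVlt => /predU1P[<- _|t0 fg]; first by rewrite mul0r (csg0 PP).
apply: (@ler_eps _ _ _ t); first exact: ltW.
move=> e e0 _; have [d d0 H] := fg e e0.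
pose n := (Num.truncn (t / d)).+1; pose h := t / n%:R.
have n0 : 0 < n%:R :> R by rewrite ltr0n.
have h0 : 0 < h by rewrite divr_gt0.
have hd : h < d.
  by rewrite ltr_pdivrMr // mulrC -ltr_pdivrMr // truncnS_gt.
have -> : t = n%:R * h by rewrite mulrC divfK ?gt_eqF.
apply: le_trans (csg_incr_mul _ _ (ltW h0)) _.
have -> : n%:R * h * N g + e * (n%:R * h) =
    n%:R * (h * (N g + e)) by ring.
rewrite ler_wpM2l ?(ltW n0) //; have := H h; rewrite h0 hd => /(_ isT) Hh.
have := nrmD ipP (P h f - f - h *: g) (h *: g).
rewrite subrK (nrmZ ipP) gtr0_norm // => /le_trans; apply.
by rewrite mulrDr addrC lerD2l mulrC.
Qed.

Lemma generator_linear a f g f' g' : generator f g -> generator f' g' ->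
  generator (a *: f + f') (a *: g + g').
Proof.
move=> fg fg' e e0; have a1 : 0 < `|a| + 1 by rewrite ltr_wpDl.
have e'0 : 0 < e / (`|a| + 1) by rewrite divr_gt0.
have [d1 d10 H1] := fg _ e'0; have [d2 d20 H2] := fg' _ e'0.
exists (Num.min d1 d2); first by rewrite lt_min d10.
move=> t; rewrite lt_min => /and3P[t0 td1 td2].
have {}H1 := H1 t; rewrite t0 td1 in H1; have {H1} := H1 isT => H1.
have {}H2 := H2 t; rewrite t0 td2 in H2; have {H2} := H2 isT => H2.
have E : P t (a *: f + f') - (a *: f + f') - t *: (a *: g + g') ~
    a *: (P t f - f - t *: g) + (P t f' - f' - t *: g').
  have -> : a *: (P t f - f - t *: g) + (P t f' - f' - t *: g') =
      (a *: P t f + P t f') - (a *: f + f') - t *: (a *: g + g').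
    rewrite !scalerBr addrACA (addrACA (a *: P t f)) -!opprD scalerDr.
    by rewrite !scalerA (mulrC a t).
  by apply: eqvB => //; apply: eqvB => //; exact: csg_linear (ltW t0).
rewrite (eqv_nrm ipP E); apply: le_trans (nrmD ipP _ _) _.
rewrite (nrmZ ipP);
  apply: (@le_trans _ _ (`|a| * (e / (`|a| + 1) * t) + e / (`|a| + 1) * t)).
  by rewrite lerD // ler_wpM2l.
have -> : `|a| * (e / (`|a| + 1) * t) + e / (`|a| + 1) * t =
   (`|a| + 1) * (e / (`|a| + 1)) * t by rewrite !mulrDl mul1r mulrA.
by rewrite (mulrC (`|a| + 1)) divfK ?gt_eqF.
Qed.

Lemma csg_generator (s : R) f g : 0 <= s -> generator f g ->
  generator (P s f) (P s g).
Proof.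
move=> s0 fg e e0; have [d d0 H] := fg e e0; exists d => // t td.
apply: le_trans (H t td); have t0 : 0 <= t by case/andP: td => /ltW.
apply: le_trans (csg_le PP _ s0).
suff E : P s (P t f - f - t *: g) ~ P t (P s f) - P s f - t *: P s g.
  by rewrite (eqv_nrm ipP E).
apply: etrans (csgB _ _ s0) _; apply: eqvB => //; last exact: csgZ.
apply: etrans (csgB _ _ s0) _; apply: eqvB => //.
apply: etrans (csgD PP _ s0 t0) _; rewrite addrC.
exact: esym (csgD PP _ t0 s0).
Qed.

(** One Euler step for [|P_s f|^2]. With [P_h f = f + h g + r], the cross term with [h g] gives the
    decay by the Poincare bound; the cross term with [r] and the square of the increment go into the
    error, where [h <= e] turns [h^2] into [h * e]. *)
Lemma generator_step f g (K e d h s : R) : 0 < K -> 0 < e -> e <= 1 ->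
    (forall t : R, 0 < t < d -> N (P t f - f - t *: g) <= e * t) ->
    N (P s f) ^+ 2 <= K * - ip (P s f) (P s g) ->
    0 <= s -> 0 < h -> h < d -> h <= e ->
  N (P (s + h) f) ^+ 2 <= (1 - 2 * h / K) * N (P s f) ^+ 2
     + h * (e * (2 * N f + (N g + 1) ^+ 2)).
Proof.
move=> K0 e0 e1 H poinc s0 h0 hd he.
have := H h; rewrite h0 hd => /(_ isT) {H}.
set r := P h f - f - h *: g => Hr.
have E : P (s + h) f ~ P s f + (h *: P s g + P s r).
  apply: etrans (esym (csgD PP f s0 (ltW h0))) _.
  have -> : P h f = f + (h *: g + r).
    by rewrite /r [h *: g + _]addrC subrK addrC subrK.
  apply: etrans (csg_add _ _ s0) _; apply: eqvD => //; exact: csg_linear.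
rewrite (eqv_nrm ipP E) (nrm_sqD ipP) (ipDr ipP) (ipZr ipP).
set w := h *: P s g + P s r; have Hw : N w ^+ 2 <= h * (e * (N g + 1) ^+ 2).
  apply: (@le_trans _ _ ((h * (N g + 1)) ^+ 2)).
    rewrite ler_pXn2r ?nnegrE ?mulr_ge0 ?addr_ge0 ?nrm_ge0 ?(ltW h0) //.
    apply: le_trans (nrmD ipP _ _) _; rewrite (nrmZ ipP) gtr0_norm // mulrDr.
    apply: lerD; first by rewrite ler_pM2l //; exact: csg_le.
    apply: le_trans (csg_le PP _ s0) _; apply: le_trans Hr _.
    by rewrite mulrC ler_wpM2l // ltW.
  by rewrite exprMn expr2 -mulrA ler_pM2l // ler_wpM2r // sqr_ge0.
have Hpr : ip (P s f) (P s r) <= N f * (e * h).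
  apply: le_trans (ip_le ipP _ _) _; apply: ler_pM; rewrite ?nrm_ge0 //.
    exact: csg_le.
  by apply: le_trans Hr; exact: csg_le.
have Hpg : h * ip (P s f) (P s g) <= - (h / K) * N (P s f) ^+ 2.
  rewrite mulNr lerNr -mulrN mulrAC -mulrA.
  by rewrite ler_pM2l // ler_pdivrMr // mulrC.
have -> : 2 * h / K = 2 * (h / K) by rewrite mulrA.
move: Hw Hpr Hpg; lra.
Qed.

(** Discrete Gronwall argument: [n] Euler steps of length [h = K / n] give the factor
    [(1 - 2h/K)^n <= e^-2], and their errors add up to a multiple of [e]. *)
Lemma generator_decay f g (K : R) : 0 < K -> generator f g ->
    (forall s : R, 0 <= s -> N (P s f) ^+ 2 <= K * - ip (P s f) (P s g)) ->
  N (P K f) <= expR (-1) * N f.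
Proof.
move=> K0 fg poinc.
rewrite -(@ler_pXn2r _ 2) ?nnegrE ?mulr_ge0 ?nrm_ge0 ?expR_ge0 //.
pose c := 2 * N f + (N g + 1) ^+ 2.
have c0 : 0 <= c by rewrite addr_ge0 ?sqr_ge0 // mulr_ge0 ?nrm_ge0.
apply: (@ler_eps _ _ _ (K * c)); first by rewrite mulr_ge0 // ltW.
move=> e e0 e1; have [d d0 H] := fg e e0.
(* The three caps on the step make the derivative estimate valid, the quadratic error of order
   [h * e], and the factor [1 - 2h/K] nonnegative. *)
pose m := Num.min (Num.min d e) (K / 2).
have m0 : 0 < m by rewrite !lt_min d0 e0 divr_gt0.
pose n := (Num.truncn (K / m)).+1; pose h := K / n%:R.
have n0 : 0 < n%:R :> R by rewrite ltr0n.
have h0 : 0 < h by rewrite divr_gt0.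
have : h < m by rewrite ltr_pdivrMr // mulrC -ltr_pdivrMr // truncnS_gt.
rewrite !lt_min => /andP[/andP[hd he] hK].
have q0 : 0 <= 1 - 2 * h / K.
  by rewrite subr_ge0 ler_pdivrMr // mul1r mulrC -ler_pdivlMr // ltW.
have q1 : 1 - 2 * h / K <= 1.
  by rewrite gerBl divr_ge0 ?mulr_ge0 // ltW.
have IH k : N (P (k%:R * h) f) ^+ 2 <=
    (1 - 2 * h / K) ^+ k * N f ^+ 2 + k%:R * (h * (e * c)).
  have hec0 : 0 <= h * (e * c) by rewrite !mulr_ge0 // ltW.
  elim: k => [|k IH].
    by rewrite !mul0r addr0 mul1r (eqv_nrm ipP (csg0 PP f)).
  rewrite -natr1 mulrDl mul1r.
  have kh : 0 <= k%:R * h by rewrite mulr_ge0 // ltW.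
  apply: le_trans (generator_step K0 e0 e1 H (poinc _ kh) kh h0 hd (ltW he)) _.
  rewrite -/c; move: (h * (e * c)) hec0 IH => hec hec0 IH.
  rewrite (mulrDl _ _ hec) mul1r addrA lerD2r [_ ^+ k.+1]exprS.
  rewrite -[_ * _ ^+ k * _]mulrA.
  apply: le_trans (ler_wpM2l q0 IH) _; rewrite mulrDr lerD2l.
  by rewrite ler_piMl // mulr_ge0.
have nh : n%:R * h = K by rewrite mulrC divfK ?gt_eqF.
have := IH n; rewrite nh mulrA nh => /le_trans; apply.
rewrite [e * (K * c)]mulrCA lerD2r exprMn ler_wpM2r ?sqr_ge0 //.
have -> : expR (-1) = expR (- (h / K)) ^+ n :> R.
  by rewrite -expRM_natl mulrN mulrA nh divff ?gt_eqF.
rewrite -exprM mulnC exprM ler_pXn2r ?nnegrE ?exprn_ge0 ?expR_ge0 //.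
rewrite -expRM_natl; apply: le_trans (expR_ge1Dx _).
by rewrite mulrN -(mulrA 2 h).
Qed.

End contraction_semigroup.

(** * Density of the domain of a generator *)

Lemma sum_ord_mul (V : nmodType) (n m : nat) (F : nat -> V) :
  \sum_(k < n * m) F k = \sum_(j < n) \sum_(i < m) F (j * m + i)%N.
Proof.
elim: n => [|n IH]; first by rewrite !big_ord0.
rewrite big_ord_recr /= -IH -(big_mkord xpredT) mulSnr.
rewrite (big_cat_nat (n := (n * m)%N)) ?leq_addr //= -{2}[(n * m)%N]add0n.
rewrite big_addn addKn !big_mkord; congr (_ + _).
by apply: eq_bigr => i _; rewrite addnC.
Qed.

Section domain_density.
Variables (R : realType) (V : lmodType R) (ip : V -> V -> R) (P : R -> V -> V).
Hypotheses (ipP : semi_inner ip) (PP : contraction_semigroup ip P).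
Local Notation N := (nrm ip).
Local Notation "u ~ v" := (eqv ip u v) (at level 70).
Let erefl u : u ~ u := eqv_refl ipP u.
Let esym u v : u ~ v -> v ~ u := @eqv_sym _ _ _ ipP u v.
Let etrans w u v : u ~ w -> w ~ v -> u ~ v := @eqv_trans _ _ _ ipP w u v.

(** The left Riemann sum of [h^-1 int_0^h P_s f ds] with [n] nodes. *)
Definition riemann (f : V) (h : R) (n : nat) : V :=
  n%:R^-1 *: \sum_(j < n) P (j%:R * (h / n%:R)) f.

Lemma nrm_mean (n : nat) (F : 'I_n -> V) (e : R) : (0 < n)%N ->
  (forall j, N (F j) <= e) -> N (n%:R^-1 *: \sum_(j < n) F j) <= e.
Proof.
move=> n0 Fe; rewrite (nrmZ ipP) ger0_norm ?invr_ge0 //.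
rewrite mulrC ler_pdivrMr ?ltr0n //.
apply: le_trans (nrm_sum ipP _ _ _) _.
apply: le_trans (ler_sum _ (fun j _ => Fe j)) _.
by rewrite sumr_const card_ord mulr_natr.
Qed.

(** Each node of the finer sum lies within [h / n] to the right of a coarse node, and by contraction
    an increment of the orbit is at most the increment of the same length at time 0. *)
Lemma riemann_refine (f : V) (h e : R) (n m : nat) :
    (0 < n)%N -> (0 < m)%N -> 0 < h ->
    (forall s : R, 0 <= s <= h / n%:R -> N (P s f - f) <= e) ->
  N (riemann f h (n * m) - riemann f h n) <= e.
Proof.
move=> n0 m0 h0 H.
have n0' : 0 < n%:R :> R by rewrite ltr0n.
have m0' : 0 < m%:R :> R by rewrite ltr0n.
have -> : riemann f h (n * m) - riemann f h n = n%:R^-1 *: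
    \sum_(j < n) (m%:R^-1 *: \sum_(i < m)
      (P ((j * m + i)%:R * (h / (n * m)%:R)) f - P (j%:R * (h / n%:R)) f)).
  rewrite /riemann; set D := h / (n * m)%:R.
  rewrite (sum_ord_mul n m (fun k => P (k%:R * D) f)) natrM invfM -scalerA.
  rewrite -scalerBr scaler_sumr -sumrB; congr (_ *: _); apply: eq_bigr => j _.
  rewrite sumrB sumr_const card_ord scalerBr.
  rewrite -[P _ f *+ m]scaler_nat scalerA.
  by rewrite mulVf ?scale1r // gt_eqF.
apply: nrm_mean => // j; apply: nrm_mean => // i.
have -> : (j * m + i)%:R * (h / (n * m)%:R) =
    j%:R * (h / n%:R) + i%:R * (h / n%:R / m%:R) :> R.
  by rewrite natrD !natrM; field; rewrite !gt_eqF.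
have hn : 0 <= h / n%:R by rewrite divr_ge0 // ltW.
have i0 : 0 <= i%:R * (h / n%:R / m%:R) by rewrite mulr_ge0 // divr_ge0.
apply: le_trans (csg_incr ipP PP _ _ i0) _; first by rewrite mulr_ge0.
apply: H; rewrite i0 mulrA ler_pdivrMr // mulrC ler_wpM2l //.
by rewrite ler_nat ltnW.
Qed.

(** The sum with one node is [f] itself, so this is a refinement of the trivial partition. *)
Lemma riemann_near (f : V) (h e : R) (n : nat) : (0 < n)%N -> 0 < h ->
    (forall s : R, 0 <= s <= h -> N (P s f - f) <= e) ->
  N (riemann f h n - f) <= e.
Proof.
move=> n0 h0 H.
have E : riemann f h 1 ~ f.
  by rewrite /riemann big_ord1 mul0r invr1 scale1r; exact: csg0.
rewrite -(eqv_nrm ipP (eqvB ipP (erefl (riemann f h n)) E)) -[n]mul1n.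
by apply: riemann_refine => // s; rewrite invr1 mulr1; exact: H.
Qed.

Lemma riemann_translate (f : V) (h r : R) (n : nat) : (0 < n)%N -> 0 < h ->
  0 <= r -> N (P r (riemann f h n) - riemann f h n) <= N (P r f - f).
Proof.
move=> n0 h0 r0.
have E : P r (riemann f h n) - riemann f h n ~ n%:R^-1 *: \sum_(j < n)
    (P (j%:R * (h / n%:R) + r) f - P (j%:R * (h / n%:R)) f).
  rewrite sumrB scalerBr; apply: eqvB => //.
  apply: etrans (csgZ ipP PP _ _ r0) _; apply: eqvZ => //.
  apply: etrans (csg_sum ipP PP _ _ _ r0) _; apply: eqv_sum => // j _.
  rewrite addrC; apply: csgD => //.
  by rewrite mulr_ge0 // divr_ge0 // ltW.
rewrite (eqv_nrm ipP E); apply: nrm_mean => // j; apply: csg_incr => //.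
by rewrite mulr_ge0 // divr_ge0 // ltW.
Qed.

(** Discrete form of [int_t^(t+h) - int_0^h = int_h^(t+h) - int_0^t]: the overlapping nodes
    cancel. *)
Lemma riemann_shift (f : V) (h : R) (n m : nat) : (0 < n)%N -> 0 < h ->
  P (m%:R * (h / n%:R)) (riemann f h n) - riemann f h n ~
  n%:R^-1 *: \sum_(j < m) P (j%:R * (h / n%:R)) (P h f - f).
Proof.
move=> n0 h0; set d := h / n%:R.
have d0 : 0 <= d by rewrite divr_ge0 // ltW.
have kd (k : nat) : 0 <= k%:R * d by rewrite mulr_ge0.
have nd : n%:R * d = h by rewrite mulrC divfK // pnatr_eq0 -lt0n.
pose a k := P (k%:R * d) f.
have E1 : P (m%:R * d) (riemann f h n) ~
    n%:R^-1 *: \sum_(j < n) a (m + j)%N.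
  apply: etrans (csgZ ipP PP _ _ (kd m)) _; apply: eqvZ => //.
  apply: etrans (csg_sum ipP PP _ _ _ (kd m)) _; apply: eqv_sum => // j _.
  by rewrite /a natrD mulrDl; exact: csgD.
have E2 : \sum_(j < m) P (j%:R * d) (P h f - f) ~
    \sum_(j < m) a (n + j)%N - \sum_(j < m) a j.
  rewrite -sumrB; apply: eqv_sum => // j _.
  apply: etrans (csgB PP _ _ (kd j)) _; apply: eqvB => //.
  apply: etrans (csgD PP _ (kd j) (ltW h0)) _.
  suff -> : j%:R * d + h = (n + j)%:R * d by exact: erefl.
  by rewrite natrD mulrDl nd addrC.
apply: etrans (eqvB ipP E1 (erefl _)) _.
apply: etrans (eqvZ ipP _ (esym E2)).
rewrite /riemann -scalerBr.
have S : \sum_(j < m) a j + \sum_(j < n) a (m + j)%N =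
    \sum_(j < n) a j + \sum_(j < m) a (n + j)%N.
  have split (p q : nat) : \sum_(j < p + q) a j =
      \sum_(j < p) a j + \sum_(j < q) a (p + j)%N by rewrite big_split_ord.
  by rewrite -!split addnC.
have -> : \sum_(j < n) a (m + j)%N =
    \sum_(j < n) a j + \sum_(j < m) a (n + j)%N - \sum_(j < m) a j.
  by rewrite -S addrC addKr.
move: (\sum_(j < n) a j) (\sum_(j < m) a (n + j)%N) (\sum_(j < m) a j).
move=> A B C.
by rewrite (addrAC _ (- C)) (addrAC A) subrr add0r; exact: erefl.
Qed.

(** With [t = m d + r] and mesh [d = h / n], the three errors come from moving by the remainder [r],
    from freezing [P_(jd) g] at [g], and from the term [(r / h) g] left over when [m d] is replaced
    by [t]. *)
Lemma riemann_generator (f : V) (h t e1 e2 : R) (n : nat) :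
    (0 < n)%N -> 0 < h -> 0 < t -> 0 <= e2 ->
    (forall s : R, 0 <= s <= h / n%:R -> N (P s f - f) <= e1) ->
    (forall s : R, 0 <= s <= t ->
      N (P s (P h f - f) - (P h f - f)) <= e2) ->
  N (P t (riemann f h n) - riemann f h n - (t / h) *: (P h f - f)) <=
    e1 + (t / h) * e2 + N (P h f - f) / n%:R.
Proof.
move=> n0 h0 t0 e20 H1 H2.
set g := P h f - f; set S := riemann f h n; pose d := h / n%:R.
have n0' : 0 < n%:R :> R by rewrite ltr0n.
have d0 : 0 < d by rewrite divr_gt0.
have [m [r [tE r0 rd]]] : exists (m : nat) (r : R),
    [/\ t = m%:R * d + r, 0 <= r & r <= d].
  exists (Num.truncn (t / d)), (t - (Num.truncn (t / d))%:R * d).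
  rewrite addrC subrK subr_ge0 -ler_pdivlMr // truncn_le; split => //.
    by rewrite ltW // divr_gt0.
  rewrite lerBlDl; apply: ltW; rewrite -[X in _ < _ + X]mul1r -mulrDl natr1.
  by rewrite -ltr_pdivrMr // truncnS_gt.
have md0 : 0 <= m%:R * d by rewrite mulr_ge0 // ltW.
have mt : m%:R * d <= t by rewrite tE lerDl.
have E : P t S ~ P (m%:R * d) (P r S).
  by rewrite [X in P X S]tE; exact: esym (csgD PP _ _ _).
have E' : P t S - S - (t / h) *: g ~
    (P (m%:R * d) (P r S) - P (m%:R * d) S) +
    (n%:R^-1 *: (\sum_(j < m) (P (j%:R * d) g - g)) - (r / h) *: g).
  have -> : n%:R^-1 *: (\sum_(j < m) (P (j%:R * d) g - g)) - (r / h) *: g =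
      n%:R^-1 *: (\sum_(j < m) P (j%:R * d) g) - (t / h) *: g.
    rewrite sumrB sumr_const card_ord scalerBr -addrA -opprD.
    rewrite -[g *+ m]scaler_nat scalerA -scalerDl tE mulrDl.
    by congr (_ - (_ + _) *: _); rewrite /d; field; rewrite !gt_eqF.
  apply: etrans (_ : _ ~ (P (m%:R * d) (P r S) - P (m%:R * d) S) +
     ((P (m%:R * d) S - S) - (t / h) *: g)) _.
    rewrite !addrA subrK; apply: eqvB => //; exact: eqvB.
  apply: eqvD => //; apply: eqvB => //; exact: riemann_shift.
rewrite (eqv_nrm ipP E') -[X in _ <= X]addrA.
apply: le_trans (nrmD ipP _ _) _; apply: lerD.
  apply: le_trans (csg_dist ipP PP _ _ md0) _.
  by apply: le_trans (riemann_translate _ n0 h0 r0) _; apply: H1; rewrite r0.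
apply: le_trans (nrmD ipP _ _) _; rewrite (nrmN ipP) !(nrmZ ipP); apply: lerD.
  rewrite ger0_norm ?invr_ge0 //.
  apply: (@le_trans _ _ (n%:R^-1 * (m%:R * e2))).
    rewrite ler_wpM2l ?invr_ge0 //; apply: le_trans (nrm_sum ipP _ _ _) _.
    rewrite -[m in m%:R]card_ord -[X in _ <= X]mulrC mulr_natr -sumr_const.
    apply: ler_sum => j _; apply: H2; rewrite mulr_ge0 ?(ltW d0) //=.
    apply: le_trans mt; rewrite ler_wpM2r ?(ltW d0) // ler_nat.
    exact: ltnW.
  rewrite mulrA ler_wpM2r // mulrC ler_pdivlMr // mulrAC -mulrA.
  by rewrite -/d.
rewrite ger0_norm ?divr_ge0 ?(ltW h0) // mulrC ler_wpM2l ?nrm_ge0 //.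
by rewrite ler_pdivrMr // mulrC.
Qed.

Hypothesis Vcomplete : forall u : nat -> V,
  (forall e : R, 0 < e -> exists k, forall i j, (k <= i)%N -> (k <= j)%N ->
     N (u i - u j) <= e) ->
  exists g, forall e : R, 0 < e -> exists k, forall i, (k <= i)%N ->
    N (u i - g) <= e.

(* The limit [u] of the Riemann sums stands for [h^-1 int_0^h P_s f ds], so its
   generator is [h^-1 (P_h f - f)]. *)
Lemma domain_dense (f : V) (e : R) : 0 < e ->
  exists u v, generator ip P u v /\ N (u - f) <= e.
Proof.
move=> e0; have e20 : 0 < e / 2 by rewrite divr_gt0.
have [d d0 Hd] := csg_cont PP f e20.
pose h := d / 2; have h0 : 0 < h by rewrite divr_gt0.
have hd : h < d by rewrite ltr_pdivrMr // ltr_pMr // ltr1n.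
clearbody h.
have fine_mesh (c : R) (x : R) : 0 < c -> exists k, forall i, (k <= i)%N ->
    x / i.+1%:R < c.
  move=> c0; exists (Num.truncn (x / c)) => i ki.
  rewrite ltr_pdivrMr ?ltr0n // mulrC -ltr_pdivrMr //.
  by apply: lt_le_trans (truncnS_gt _) _; rewrite ler_nat.
have osc (c : R) : 0 < c -> exists k, forall i, (k <= i)%N ->
    forall s : R, 0 <= s <= h / i.+1%:R -> N (P s f - f) <= c.
  move=> c0; have [d' d'0 Hd'] := csg_cont PP f c0.
  have [k Hk] := fine_mesh _ h d'0; exists k => i ki s /andP[s0 sh].
  by apply: Hd'; rewrite s0 (le_lt_trans sh) // Hk.
pose S i := riemann f h i.+1.
have [u Hu] : exists u, forall c : R, 0 < c -> exists k, forall i, (k <= i)%N ->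
    N (S i - u) <= c.
  apply: Vcomplete => c c0; have c20 : 0 < c / 2 by rewrite divr_gt0.
  have [k Hk] := osc _ c20; exists k => i j ki kj.
  (* Two sums are compared through their common refinement. *)
  apply: le_trans (nrm_triangle ipP (riemann f h (i.+1 * j.+1)) _ _) _.
  rewrite [c]splitr lerD //.
    rewrite (nrmB ipP); apply: riemann_refine => //; exact: Hk.
  rewrite mulnC; apply: riemann_refine => //; exact: Hk.
set g := P h f - f.
exists u, (h^-1 *: g); split; last first.
  have [k Hk] := Hu _ e20.
  apply: le_trans (nrm_triangle ipP (S k) _ _) _.
  rewrite [e]splitr lerD //; first by rewrite (nrmB ipP); exact: Hk.
  apply: riemann_near => // s /andP[s0 sh]; apply: Hd.
  by rewrite s0 (le_lt_trans sh).
move=> c c0; have hc0 : 0 < h * c by rewrite mulr_gt0.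
(* The tolerance for [g] is [h * c] because it enters with the factor [t / h] and has to end as
   [c * t]. The 4 in the next step counts two distances between [u] and [S k], one oscillation of
   the orbit of [f], and [N g / k.+1]. *)
have [d' d'0 Hd'] := csg_cont PP g hc0; exists d' => // t /andP[t0 td'].
apply: (@ler_eps _ _ _ 4) => // r r0 _.
have [k1 Hk1] := Hu _ r0; have [k2 Hk2] := osc _ r0.
have [k3 Hk3] := fine_mesh _ (N g) r0.
pose k := maxn k1 (maxn k2 k3).
have {}Hk1 := Hk1 k (leq_maxl _ _).
have {}Hk2 := Hk2 k (leq_trans (leq_maxl _ _) (leq_maxr _ _)).
have {}Hk3 := Hk3 k (leq_trans (leq_maxr _ _) (leq_maxr _ _)).
have H2 (s : R) : 0 <= s <= t -> N (P s g - g) <= h * c.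
  by move=> /andP[s0 st]; apply: Hd'; rewrite s0 (le_lt_trans st).
have := riemann_generator (ltn0Sn k) h0 t0 (ltW hc0) Hk2 H2.
rewrite -/g -/(S k).
have -> : t / h * (h * c) = c * t.
  by field; rewrite gt_eqF.
move=> H; have -> : P t u - u - t *: (h^-1 *: g) =
    (P t u - P t (S k)) + ((S k - u) + (P t (S k) - S k - (t / h) *: g)).
  rewrite scalerA; set a := P t (S k); set b := S k.
  rewrite [b - u + _]addrA [b - u + (a - b)]addrC [a - b + _]addrA subrK.
  by rewrite !addrA subrK.
apply: le_trans (nrmD ipP _ _) _.
have -> : c * t + r * 4 = r + (r + (r + c * t + r)) by ring.
apply: lerD.
  by apply: le_trans (csg_dist ipP PP _ _ (ltW t0)) _; rewrite (nrmB ipP).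
apply: le_trans (nrmD ipP _ _) _; apply: lerD => //.
by apply: le_trans H _; rewrite lerD2l ltW.
Qed.

End domain_density.
(** * Poincare inequality and relaxation *)

Section relaxation.
Variables (R : realType) (V : lmodType R) (ip : V -> V -> R) (P : R -> V -> V).
Hypotheses (ipP : semi_inner ip) (PP : contraction_semigroup ip P).
Local Notation N := (nrm ip).
Variable one : V.
Hypotheses (one1 : ip one one = 1)
  (P_one : forall t : R, 0 <= t -> eqv ip (P t one) one)
  (P_mean : forall (t : R) f, 0 <= t -> ip (P t f) one = ip f one).

Lemma generator_one : generator ip P one 0.
Proof.
move=> e e0; exists 1 => // t /andP[t0 _].
by rewrite scaler0 subr0 P_one ?mulr_ge0 // ltW.
Qed.

Lemma nrm_one : N one = 1. Proof. by rewrite /nrm one1 sqrtr1. Qed.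

(** The semigroup preserves the domain and the mean, so the Poincare inequality holds along a whole
    orbit. The value [K = 0] is separate: there the inequality makes centred domain elements
    null. *)
Lemma relaxation_of_poincare (K : R) : 0 <= K ->
    (forall f e, 0 < e -> exists u v, generator ip P u v /\ N (u - f) <= e) ->
    (forall f g, generator ip P f g -> ip f one = 0 ->
      N f ^+ 2 <= K * - ip f g) ->
  forall f, ip f one = 0 -> N (P K f) <= expR (-1) * N f.
Proof.
move=> K0 dense poinc f f0.
have dom u v : generator ip P u v -> ip u one = 0 ->
    N (P K u) <= expR (-1) * N u.
  move=> uv u0; have [K_gt0|K_le0] := ltP 0 K.
    apply: (generator_decay ipP PP K_gt0 uv) => s s0; apply: poinc.
      exact: csg_generator.
    by rewrite P_mean.
  have K00 : K = 0 by apply/eqP; rewrite eq_le K_le0 K0.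
  apply: le_trans (csg_le PP _ K0) _.
  have := poinc _ _ uv u0; rewrite K00 mul0r => Nu.
  have -> : N u = 0.
    by apply/eqP; rewrite -sqrf_eq0 eq_le Nu sqr_ge0.
  by rewrite mulr0.
apply: (@ler_eps _ _ _ 4) => // e e0 _.
have [u [v [uv ue]]] := dense f e e0.
(* The approximant [u] need not be centred. Its mean is at most [e] in absolute value because [f] is
   centred, so subtracting it costs another [e]. *)
pose u' := (- ip u one) *: one + u.
have u'v : generator ip P u' (- ip u one *: 0 + v).
  by apply: generator_linear => //; exact: generator_one.
have u'0 : ip u' one = 0.
  by rewrite /u' (ipDl ipP) (ipZl ipP) one1 mulr1 addNr.
have {u'v}H := dom _ _ u'v u'0.
have u'f : N (u' - f) <= 2 * e.
  rewrite /u' -addrA; apply: le_trans (nrmD ipP _ _) _.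
  rewrite (nrmZ ipP) nrm_one mulr1 normrN.
  have -> : ip u one = ip (u - f) one by rewrite (ipBl ipP) f0 subr0.
  have := cauchy_schwarz ipP (u - f) one; rewrite nrm_one mulr1.
  by move: ue; lra.
have h1 := csg_dist ipP PP f u' K0.
have h2 := nrm_triangle ipP (P K u') (P K f) 0; rewrite !subr0 in h2.
have h3 := nrm_triangle ipP f u' 0; rewrite !subr0 in h3.
have q1 : expR (-1) <= 1 :> R by rewrite expR_le1.
have q0 : 0 <= expR (-1) :> R := expR_ge0 _.
have h4 : expR (-1) * N u' <= expR (-1) * N f + 2 * e.
  apply: (@le_trans _ _ (expR (-1) * N f + expR (-1) * (2 * e))).
    by rewrite -mulrDr ler_wpM2l //; move: h3 u'f; lra.
  by rewrite lerD2l ler_piMl // mulr_ge0 // ltW.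
rewrite [N (f - u')](nrmB ipP) in h1.
move: h1 h2 h4 H u'f; lra.
Qed.

Lemma ip_close u v u' v' (e : R) : e <= 1 ->
    N (u' - u) <= e -> N (v' - v) <= e ->
  `|ip u' v' - ip u v| <= e * (N u + N v + 1).
Proof.
move=> e1 hu hv.
have -> : ip u' v' - ip u v = ip u (v' - v) + ip (u' - u) v
    + ip (u' - u) (v' - v).
  by rewrite !(ipBl ipP) !(ipBr ipP); ring.
have e0 : 0 <= e := le_trans (nrm_ge0 _ _) hu.
have -> : e * (N u + N v + 1) = N u * e + e * N v + e * 1 by ring.
apply: le_trans (ler_normD _ _) _; apply: lerD.
  apply: le_trans (ler_normD _ _) _; apply: lerD;
    apply: le_trans (cauchy_schwarz ipP _ _) _.
    by rewrite ler_wpM2l // nrm_ge0.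
  by rewrite ler_wpM2r // nrm_ge0.
apply: le_trans (cauchy_schwarz ipP _ _) _.
by apply: ler_pM; rewrite ?nrm_ge0 //; exact: le_trans e1.
Qed.

(** Both sides are continuous in the graph norm. The inequality is in variance form because a core
    need not contain the constants, so its elements cannot be centred inside it. *)
Lemma poincare_of_core (C : V -> Prop) (a b : R) : 0 <= a -> 0 <= b ->
    (forall f g, generator ip P f g -> forall e : R, 0 < e ->
      exists f' g', [/\ C f', generator ip P f' g',
        N (f' - f) <= e & N (g' - g) <= e]) ->
    (forall f g, C f -> generator ip P f g ->
      a * (N f ^+ 2 - ip f one ^+ 2) <= b * - ip f g) ->
  forall f g, generator ip P f g ->
    a * (N f ^+ 2 - ip f one ^+ 2) <= b * - ip f g.
Proof.
move=> a0 b0 core H f g fg.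
(* Per unit of [e <= 1], these bound the change of [N f ^+ 2], of the squared mean and of [ip f g]
   when [f] and [g] are replaced by their core approximations. *)
pose c1 := N f + N f + 1; pose c2 := (N f + 1 + 1) * (2 * N f + 1).
pose c3 := N f + N g + 1.
have Nf := nrm_ge0 ip f; have Ng := nrm_ge0 ip g.
apply: (@ler_eps _ _ _ (a * (c1 + c2) + b * c3)).
  by rewrite !(addr_ge0, mulr_ge0).
move=> e e0 e1; have [f' [g' [Cf' fg' ff' gg']]] := core _ _ fg e e0.
have oo : N (one - one) <= e by rewrite subrr (nrm0 ipP) ltW.
have k1 := ip_close e1 ff' ff'; have k3 := ip_close e1 ff' gg'.
have k2 := ip_close e1 ff' oo; rewrite nrm_one in k2.
rewrite -!(nrm_sq ipP) in k1.
have m1 := cauchy_schwarz ipP f one; rewrite nrm_one mulr1 in m1.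
have m2 := cauchy_schwarz ipP f' one; rewrite nrm_one mulr1 in m2.
have Nf' : N f' <= N f + 1.
  by rewrite -[f'](subrK f); apply: le_trans (nrmD ipP _ _) _;
     rewrite addrC lerD2l (le_trans ff').
have {}k2 : `|ip f' one ^+ 2 - ip f one ^+ 2| <= e * c2.
  rewrite subr_sqr normrM /c2 mulrA; apply: ler_pM => //.
  apply: le_trans (ler_normD _ _) _; move: m1 m2 Nf'; lra.
have := H _ _ Cf' fg'.
have A : N f ^+ 2 - ip f one ^+ 2 <=
    N f' ^+ 2 - ip f' one ^+ 2 + e * (c1 + c2).
  rewrite (mulrDr e); move: k1 k2; rewrite !ler_norml -/c1.
  by move: (e * c1) (e * c2) => x y /andP[? _] /andP[_ ?]; lra.
have B : - ip f' g' <= - ip f g + e * c3.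
  by move: k3; rewrite ler_norml -/c3; move: (e * c3) => x /andP[? _]; lra.
have {}A := ler_wpM2l a0 A; have {}B := ler_wpM2l b0 B.
move=> HH; apply: le_trans A _; rewrite mulrDr.
apply: (@le_trans _ _ (b * - ip f g + b * (e * c3) + a * (e * (c1 + c2)))).
  by rewrite lerD2r (le_trans HH) // -mulrDr.
by rewrite -addrA lerD2l le_eqVlt; apply/orP; left; apply/eqP; ring.
Qed.

End relaxation.

Lemma lift_relaxation (R : realType) (V W : lmodType R)
    (ipV : V -> V -> R) (ipW : W -> W -> R) (P : R -> V -> V) (Q : R -> W -> W)
    (oneV : V) (oneW : W) (J : V -> W) (C : V -> Prop) (t : R) :
  semi_inner ipV -> semi_inner ipW ->
  contraction_semigroup ipV P -> contraction_semigroup ipW Q ->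
  ipV oneV oneV = 1 -> ipW oneW oneW = 1 ->
  (forall s : R, 0 <= s -> eqv ipV (P s oneV) oneV) ->
  (forall s : R, 0 <= s -> eqv ipW (Q s oneW) oneW) ->
  (forall (s : R) f, 0 <= s -> ipV (P s f) oneV = ipV f oneV) ->
  (forall u, ipW (J u) (J u) = ipV u u) ->
  (forall u, ipW (J u) oneW = ipV u oneV) ->
  (forall f e, 0 < e ->
    exists u v, generator ipV P u v /\ nrm ipV (u - f) <= e) ->
  (forall f g, generator ipV P f g -> forall e : R, 0 < e ->
    exists f' g', [/\ C f', generator ipV P f' g',
      nrm ipV (f' - f) <= e & nrm ipV (g' - g) <= e]) ->
  (forall f g, C f -> generator ipV P f g ->
    exists2 F, generator ipW Q (J f) F & 2^-1 * ipW F F = - ipV f g) ->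
  0 <= t ->
  (forall w, ipW w oneW = 0 -> nrm ipW (Q t w) <= expR (-1) * nrm ipW w) ->
  forall f, ipV f oneV = 0 ->
    nrm ipV (P (2 * t ^+ 2 / (1 - expR (-1)) ^+ 2) f) <= expR (-1) * nrm ipV f.
Proof.
move=> ipVP ipWP PP QP oneV1 oneW1 PoneV QoneW Pmean J2 Jone dense core lift.
move=> t0 relax.
have a0 : 0 < 1 - expR (-1) :> R by rewrite subr_gt0 expR_lt1 // ltrN10.
set a := 1 - _ in a0 *.
have K0 : 0 <= 2 * t ^+ 2 / a ^+ 2.
  by rewrite divr_ge0 ?sqr_ge0 // mulr_ge0 ?sqr_ge0.
apply: relaxation_of_poincare => // f g fg f0.
suff : a ^+ 2 * (nrm ipV f ^+ 2 - ipV f oneV ^+ 2) <=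
    2 * t ^+ 2 * - ipV f g.
  move=> H; rewrite mulrAC ler_pdivlMr ?exprn_gt0 // mulrC.
  by move: H; rewrite f0 expr0n subr0.
apply: (@poincare_of_core _ _ _ _ ipVP _ oneV1 C) fg; rewrite ?sqr_ge0 //.
  by rewrite mulr_ge0 ?sqr_ge0.
move=> {f0}{}f {}g Cf fg; have [F JF FF] := lift _ _ Cf fg.
(* Constants have generator 0, so centring [J f] does not change its generator [F]. *)
pose m := ipV f oneV; pose w := (- m) *: oneW + J f.
have w0 : ipW w oneW = 0.
  by rewrite /w (ipDl ipWP) (ipZl ipWP) oneW1 Jone mulr1 addNr.
have Nw : nrm ipW w ^+ 2 = nrm ipV f ^+ 2 - m ^+ 2.
  rewrite /w (nrm_sqD ipWP) !(nrm_sq ipWP) (nrm_sq ipVP) J2 !(ipZl ipWP).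
  by rewrite (ipZr ipWP) oneW1 (ipC ipWP oneW) Jone -/m; ring.
have wF : generator ipW Q w ((- m) *: 0 + F).
  by apply: generator_linear => //; exact: generator_one.
have := generator_le ipWP QP t0 wF; rewrite scaler0 add0r => wQ.
have aw : a * nrm ipW w <= t * nrm ipW F.
  have := relax _ w0.
  have := nrm_triangle ipWP (Q t w) w 0; rewrite !subr0 (nrmB ipWP).
  by rewrite /a; move: wQ; lra.
rewrite -/m -Nw; have FF2 : nrm ipW F ^+ 2 = 2 * - ipV f g.
  by rewrite (nrm_sq ipWP) -FF mulrA divff ?mul1r // pnatr_eq0.
have -> : 2 * t ^+ 2 * - ipV f g = t ^+ 2 * nrm ipW F ^+ 2.
  by rewrite FF2; ring.
by rewrite -!exprMn ler_pXn2r // ?nnegrE ?mulr_ge0 ?nrm_ge0 // ltW.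
Qed.
(** * Markov semigroups on square-integrable functions *)

Section integral_kernel.
Context d1 d2 (T1 : measurableType d1) (T2 : measurableType d2) (R : realType).
Variables (m1 : {measure set T1 -> \bar R}) (m2 : {measure set T2 -> \bar R}).
Variable k : R.-ker T1 ~> T2.
Hypothesis km : forall A, measurable A -> (\int[m1]_x k x A)%E = m2 A.
Import HBNNSimple.
Local Open Scope ereal_scope.

Let integral_kernel_nnsfun (g : {nnsfun T2 >-> R}) :
  \int[m1]_x \int[k x]_y (g y)%:E = \int[m2]_y (g y)%:E.
Proof.
rewrite integralT_nnsfun sintegralE.
under eq_integral do rewrite integralT_nnsfun sintegralE.
rewrite ge0_integral_fsum//; last 2 first.
  by move=> r; apply: measurable_funeM; exact: measurable_kernel.
  by move=> r x _; exact: nnsfun_mulemu_ge0.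
apply: eq_fsbigr => r _.
have [r0|r0] := leP 0%R r.
  rewrite ge0_integralZl//; last exact: measurable_kernel.
  by rewrite km.
have -> : g @^-1` [set r] = set0 by exact: preimage_nnfun0.
rewrite measure0 mule0; apply: integral0_eq => x _.
by rewrite measure0 mule0.
Qed.

(** Two measures are kept apart in order to cover both invariance ([m1 = m2]) and the
    Chapman-Kolmogorov equation ([m1 = p s x], [m2 = p (s + t) x]). *)
Lemma ge0_integral_kernel (f : T2 -> \bar R) :
  measurable_fun [set: T2] f -> (forall y, 0 <= f y) ->
  \int[m1]_x \int[k x]_y f y = \int[m2]_y f y.
Proof.
move=> mf f0.
pose g := nnsfun_approx measurableT mf.
pose gE := fun n => EFin \o g n.
have mgE n : measurable_fun [set: T2] (gE n) by exact/measurable_EFinP.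
have gE0 n x : 0 <= gE n x by rewrite lee_fin.
have nd_gE x : {homo gE ^~ x : n m / (n <= m)%O >-> n <= m}.
  by move=> *; exact/lefP/nd_nnsfun_approx.
have fE (m : {measure set T2 -> \bar R}) :
    \int[m]_y f y = limn (fun n => \int[m]_y gE n y).
  rewrite -monotone_convergence//; apply: eq_integral => t _.
  by apply/esym/cvg_lim => //; exact: cvg_nnsfun_approx.
rewrite fE; transitivity (limn (fun n => \int[m1]_x \int[k x]_y gE n y)).
  rewrite -monotone_convergence//; last 3 first.
  - move=> n; apply: measurable_fun_integral_kernel => //.
    exact: measurable_kernel.
  - by move=> n x _; exact: integral_ge0.
  - by move=> x _ a b ab; apply: ge0_le_integral => // t _; exact: nd_gE.
  by apply: eq_integral => x _; rewrite fE.
by apply: congr_lim; apply/funext => n; rewrite integral_kernel_nnsfun.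
Qed.

Lemma measurable_integral_kernel (f : T2 -> R) :
  measurable_fun [set: T2] f ->
  measurable_fun [set: T1] (fun x => \int[k x]_y f y)%R.
Proof.
move=> mf; apply: measurableT_comp => //.
under eq_fun do rewrite integralE.
by apply: emeasurable_funB; apply: measurable_fun_integral_kernel => //;
  [exact: measurable_kernel | apply: measurable_funepos; exact/measurable_EFinP
  | exact: measurable_kernel | apply: measurable_funeneg;
    exact/measurable_EFinP].
Qed.

(** Outside this set of full measure the real-valued integral [\int[k x]_y f y] may be a default
    value; this is why linearity and the semigroup law hold almost everywhere only. *)
Lemma integrable_kernel_ae (f : T2 -> R) : m2.-integrable setT (EFin \o f) ->
  {ae m1, forall x, (k x).-integrable setT (EFin \o f)}.
Proof.
move=> /integrableP[mf fi].
have mk : measurable_fun setT (fun x => \int[k x]_y `|f y|%:E).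
  apply: measurable_fun_integral_kernel => //; first exact: measurable_kernel.
  by apply/measurable_EFinP; apply: measurableT_comp => //;
    exact/measurable_EFinP.
have : m1.-integrable setT (fun x => \int[k x]_y `|f y|%:E).
  apply/integrableP; split => //.
  under eq_integral do rewrite gee0_abs ?integral_ge0//.
  rewrite (@ge0_integral_kernel (fun y => `|f y|%:E)) //.
  by apply/measurable_EFinP; apply: measurableT_comp => //;
    exact/measurable_EFinP.
move=> /(integrable_ae measurableT); apply: filterS => x /(_ I) fin.
apply/integrableP; split => //.
by rewrite ltey_eq fin.
Qed.

Lemma Rintegral_kernel (f : T2 -> R) : m2.-integrable setT (EFin \o f) ->
  (\int[m1]_x \int[k x]_y f y = \int[m2]_y f y)%R.
Proof.
move=> fi; have mf := measurable_int _ fi.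
have mp : measurable_fun setT (EFin \o f)^\+ by exact: measurable_funepos.
have mn : measurable_fun setT (EFin \o f)^\- by exact: measurable_funeneg.
have mkp : measurable_fun setT (fun x => \int[k x]_y (EFin \o f)^\+ y).
  apply: measurable_fun_integral_kernel => //; exact: measurable_kernel.
have mkn : measurable_fun setT (fun x => \int[k x]_y (EFin \o f)^\- y).
  apply: measurable_fun_integral_kernel => //; exact: measurable_kernel.
have ip : m1.-integrable setT (fun x => \int[k x]_y (EFin \o f)^\+ y).
  apply/integrableP; split => //.
  under eq_integral do rewrite gee0_abs ?integral_ge0//.
  rewrite ge0_integral_kernel //.
  by have /integrableP[_] := integrable_funepos measurableT fi;
    under eq_integral do rewrite gee0_abs//.
have in_ : m1.-integrable setT (fun x => \int[k x]_y (EFin \o f)^\- y).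
  apply/integrableP; split => //.
  under eq_integral do rewrite gee0_abs ?integral_ge0//.
  rewrite ge0_integral_kernel //.
  by have /integrableP[_] := integrable_funeneg measurableT fi;
    under eq_integral do rewrite gee0_abs//.
rewrite /Rintegral; congr fine.
rewrite [RHS]integralE -!ge0_integral_kernel //.
rewrite -integralB //; apply: ae_eq_integral => //.
- apply/measurable_EFinP; apply: measurable_integral_kernel.
  exact/measurable_EFinP.
- exact: emeasurable_funB.
have := integrable_kernel_ae fi; apply: filterS => x ki _.
by rewrite fineK ?integral_fune_fin_num // integralE.
Qed.

End integral_kernel.

(** * Square-integrable functions as a semi-inner product space *)

Section L2_space.
Context d (T : measurableType d) (R : realType).
Variable m : {measure set T -> \bar R}.

Lemma L2_sqr_integrable (f : T -> R) : measurable_fun setT f ->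
  ((\int[m]_x (f x ^+ 2)%:E) < +oo)%E -> f \in Lfun m 2%:E.
Proof.
move=> mf fi; rewrite inE; apply/andP; split; rewrite inE //=.
rewrite /finite_norm unlock poweR_lty //.
under eq_integral => x _ do
  rewrite /= powR_mulrn ?normr_ge0 // real_normK ?num_real //.
by [].
Qed.

Lemma L2_measurable (f : T -> R) : f \in Lfun m 2%:E -> measurable_fun setT f.
Proof. by rewrite inE => /andP[]; rewrite inE. Qed.

Lemma L2_mul_integrable (f g : T -> R) : f \in Lfun m 2%:E ->
  g \in Lfun m 2%:E -> m.-integrable setT (fun x => (f x * g x)%:E).
Proof. by move=> hf hg; apply/Lfun1_integrable; exact: Lfun2_mul_Lfun1. Qed.

Lemma L2_inner_sqr (f : T -> R) : f \in Lfun m 2%:E ->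
  (\int[m]_x (f x ^+ 2)%:E)%E = (L2inner m f f)%:E.
Proof.
move=> hf; rewrite /L2inner /Rintegral fineK //.
exact/integrable_fin_num/L2_mul_integrable.
Qed.

Lemma L2norm_inner (f : T -> R) : f \in Lfun m 2%:E ->
  L2norm m f = (Num.sqrt (L2inner m f f))%:E.
Proof.
move=> hf; rewrite /L2norm unlock.
under eq_integral => x _ do
  rewrite /= powR_mulrn ?normr_ge0 // real_normK ?num_real //.
rewrite L2_inner_sqr // poweR_EFin powR12_sqrt //.
by apply: Rintegral_ge0 => x _; rewrite -expr2 sqr_ge0.
Qed.

Definition le12 : (1 <= 2%:E :> \bar R)%E := lee1n 2.

Definition L2fun := LfunType m le12.

Definition L2ip (f g : L2fun) : R := L2inner m f g.

Lemma L2funP (f : L2fun) : (f : T -> R) \in Lfun m 2%:E.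
Proof. exact: LfunP. Qed.

Lemma L2ipP : semi_inner L2ip.
Proof.
split=> [f g|a f g h|f].
- by apply: eq_Rintegral => x _; rewrite mulrC.
- have fh := L2_mul_integrable (L2funP f) (L2funP h).
  have gh := L2_mul_integrable (L2funP g) (L2funP h).
  rewrite /L2ip /L2inner -RintegralZl // -RintegralD //.
    by apply: eq_Rintegral => x _; rewrite /= mulrDl mulrA.
  have := integrableZl measurableT a fh; exact: id.
- by apply: Rintegral_ge0 => x _; rewrite -expr2 sqr_ge0.
Qed.

Lemma L2norm_nrm (f : L2fun) : L2norm m f = (nrm L2ip f)%:E.
Proof. by rewrite L2norm_inner // L2funP. Qed.

Lemma L2_ae_eqv (f g : L2fun) : {ae m, forall x, f x = g x} -> eqv L2ip f g.
Proof.
move=> fg; rewrite /eqv /nrm /L2ip /L2inner.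
suff -> : \int[m]_x ((f - g) x * (f - g) x) = 0 by rewrite sqrtr0.
have mfg : measurable_fun setT (f - g : L2fun) := L2_measurable (L2funP _).
rewrite /Rintegral (ae_eq_integral (cst 0%E)) ?integral0 //.
  by apply/measurable_EFinP; exact: measurable_funM.
by apply: filterS fg => x fgx _;
  rewrite /= [X in X * _](_ : _ = f x - g x) // fgx subrr mul0r.
Qed.

(* [toL2 f] is [0] when [f] is not square integrable. *)
Definition toL2 (f : T -> R) : L2fun := insubd (0 : L2fun) f.

Lemma toL2K f : f \in Lfun m 2%:E -> toL2 f = f :> (T -> R).
Proof. by move=> hf; exact: (insubdK (0 : L2fun)). Qed.

Hypothesis mT : m setT = 1%E.

Lemma L2_cst c : cst c \in Lfun m 2%:E.
Proof.
apply: L2_sqr_integrable => //=.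
by rewrite integral_cst // [X in (_ * X)%E]mT mule1 ltry.
Qed.

Definition L2one : L2fun := toL2 (cst 1).

Lemma L2oneE x : L2one x = 1.
Proof. by rewrite /L2one toL2K // L2_cst. Qed.

Lemma L2ip_one (f : L2fun) : L2ip f L2one = \int[m]_x f x.
Proof. by apply: eq_Rintegral => x _; rewrite L2oneE mulr1. Qed.

Lemma L2ip_one1 : L2ip L2one L2one = 1.
Proof.
rewrite L2ip_one; under eq_Rintegral do rewrite L2oneE.
by rewrite Rintegral_cst // [m _]mT mulr1.
Qed.

Lemma L2_integrable (f : T -> R) : f \in Lfun m 2%:E ->
  m.-integrable setT (EFin \o f).
Proof.
move=> hf; have := L2_mul_integrable hf (L2_cst 1).
by under eq_fun do rewrite mulr1.
Qed.

(** Cauchy-Schwarz against the constant 1. Functions with infinite square integral are included so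
    that the bound applies under every kernel measure [p t x], not just almost every one. *)
Lemma jensen_sqr (f : T -> R) : measurable_fun setT f ->
  (((\int[m]_x f x)%R ^+ 2)%:E <= \int[m]_x (f x ^+ 2)%:E)%E.
Proof.
move=> mf; have [fi|] := ltP (\int[m]_x (f x ^+ 2)%:E)%E +oo%E; last first.
  by apply: le_trans; rewrite leey.
have hf := L2_sqr_integrable mf fi; rewrite (L2_inner_sqr hf) lee_fin.
have := cauchy_schwarz L2ipP (toL2 f) L2one.
rewrite (nrm_one L2ip_one1) mulr1 L2ip_one toL2K // => H.
rewrite -real_normK ?num_real //;
  apply: (@le_trans _ _ (nrm L2ip (toL2 f) ^+ 2)).
  by rewrite ler_pXn2r ?nnegrE ?nrm_ge0.
by rewrite (nrm_sq L2ipP) /L2ip toL2K.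
Qed.

End L2_space.

(** * The contraction semigroup induced by a transition function *)

Section L2_semigroup.
Context d (T : measurableType d) (R : realType).
Variables (m : {measure set T -> \bar R}) (p : R -> R.-pker T ~> T).
Hypotheses (mT : m setT = 1%E) (tp : transition_function p)
  (ip : invariant_measure m p) (sc : strongly_continuous m p).

Let invk t (t0 : 0 <= t) A (mA : measurable A) :
  (\int[m]_x p t x A)%E = m A := ip t0 mA.

Lemma measurable_semigroup t (f : T -> R) : measurable_fun setT f ->
  measurable_fun setT (semigroup p t f).
Proof. exact: measurable_integral_kernel. Qed.

(** Jensen under each [p t x], then integration against the invariant measure. *)
Lemma semigroup_sqr_le t (f : T -> R) : 0 <= t -> measurable_fun setT f ->
  (\int[m]_x (semigroup p t f x ^+ 2)%:E <= \int[m]_x (f x ^+ 2)%:E)%E.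
Proof.
move=> t0 mf.
have mf2 : measurable_fun setT (fun x => (f x ^+ 2)%:E).
  by apply/measurable_EFinP; exact: measurable_funX.
have f20 x : (0 <= (f x ^+ 2)%:E)%E by rewrite lee_fin sqr_ge0.
rewrite -(ge0_integral_kernel (invk t0) mf2 f20).
apply: ge0_le_integral => //.
- by move=> x _; rewrite lee_fin sqr_ge0.
- by apply/measurable_EFinP; apply: measurable_funX;
  exact: measurable_semigroup.
- by apply: measurable_fun_integral_kernel => //; exact: measurable_kernel.
- by move=> x _; apply: jensen_sqr => //; exact: prob_kernel.
Qed.

Lemma semigroup_L2 t (f : T -> R) : 0 <= t -> f \in Lfun m 2%:E ->
  semigroup p t f \in Lfun m 2%:E.
Proof.
move=> t0 hf; apply: L2_sqr_integrable.
  by apply: measurable_semigroup; exact: L2_measurable hf.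
apply: le_lt_trans (semigroup_sqr_le t0 (L2_measurable hf)) _.
by rewrite (L2_inner_sqr hf) ltry.
Qed.

Definition L2op t (f : L2fun m) : L2fun m := toL2 m (semigroup p t f).

Lemma L2opE t f : 0 <= t -> L2op t f = semigroup p t f :> (T -> R).
Proof. by move=> t0; rewrite /L2op toL2K // semigroup_L2 // L2funP. Qed.

Lemma L2_kernel_ae t (f : T -> R) : 0 <= t -> f \in Lfun m 2%:E ->
  {ae m, forall x, (p t x).-integrable setT (EFin \o f)}.
Proof.
by move=> t0 hf; apply: integrable_kernel_ae (invk t0) _ (L2_integrable mT hf).
Qed.

Lemma semigroup_mean t (f : T -> R) : 0 <= t -> f \in Lfun m 2%:E ->
  \int[m]_x semigroup p t f x = \int[m]_x f x.
Proof.
by move=> t0 hf; exact: Rintegral_kernel (invk t0) _ (L2_integrable mT hf).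
Qed.

Lemma semigroup0 (f : T -> R) x : measurable_fun setT f ->
  semigroup p 0 f x = f x.
Proof.
move=> mf; have mf' : measurable_fun setT (EFin \o f) by exact/measurable_EFinP.
rewrite /semigroup /Rintegral (@eq_measure_integral _ _ _ _ \d_x) => [|A mA _].
  by rewrite integral_dirac // diracT mul1e.
by case: tp => + _; exact.
Qed.

Lemma ereal_cvg0P (F : R -> \bar R) : (forall t, 0 < t -> (0 <= F t)%E) ->
  F t @[t --> 0^'+] --> 0%E <->
  forall e : R, 0 < e -> exists2 r : R, 0 < r &
    forall t, 0 < t < r -> (F t <= e%:E)%E.
Proof.
move=> F0; split=> [cF e e0|H].
  have : \forall t \near 0^'+, (F t < e%:E)%E.
    by apply: (cF [set y | (y < e%:E)%E]); apply: open_ereal_lt';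
      rewrite lte_fin.
  move=> [r /= r0 Hr]; exists r => // t /andP[t0 tr]; apply/ltW/Hr => //=.
  by rewrite sub0r normrN gtr0_norm.
have pF : \forall t \near 0^'+, F t \is a fin_num.
  have [r r0 Hr] := H 1 ltr01; exists r => //= t /=.
  rewrite sub0r normrN => tr t0; rewrite gtr0_norm // in tr.
  have := Hr t; rewrite t0 tr => /(_ isT) Ft.
  by rewrite ge0_fin_numE ?F0 // (le_lt_trans Ft) // ltry.
apply/fine_cvgP; split => //; apply/cvgrPdist_le => e e0.
have [r r0 Hr] := H e e0; near=> t.
have t0 : 0 < t by near: t; exact: nbhs_right_gt.
have tr : t < r by near: t; exact: nbhs_right_lt.
have := Hr t; rewrite t0 tr => /(_ isT) Ft.
have Fg := F0 t t0.
rewrite /= sub0r normrN ger0_norm ?fine_ge0 // -lee_fin fineK //.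
by rewrite ge0_fin_numE // (le_lt_trans Ft) // ltry.
Unshelve. all: by end_near. Qed.

Lemma L2op_csg : contraction_semigroup (@L2ip _ _ _ m) L2op.
Proof.
have eqvE := L2_ae_eqv.
have op0 (f : L2fun m) : eqv (@L2ip _ _ _ m) (L2op 0 f) f.
  by apply: eqvE; apply: aeW => x; rewrite L2opE // semigroup0.
split=> //.
- move=> s t f s0 t0; apply: eqvE.
  have st : 0 <= s + t by rewrite addr_ge0.
  apply: filterS (L2_kernel_ae st (L2funP f)) => x fi.
  rewrite !L2opE //; apply: Rintegral_kernel fi => A mA.
  by case: tp => _ -> .
- move=> t a f g t0; apply: eqvE.
  apply: filterS2 (L2_kernel_ae t0 (L2funP f)) (L2_kernel_ae t0 (L2funP g)).
  move=> x fi gi; rewrite L2opE //.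
  have -> : (a *: L2op t f + L2op t g) x = a * L2op t f x + L2op t g x by [].
  rewrite !L2opE // /semigroup -RintegralZl // -RintegralD //.
  exact: (integrableZl measurableT a fi).
- move=> t f t0; rewrite /nrm ler_wsqrtr // /L2ip -lee_fin.
  by rewrite -!L2_inner_sqr ?L2funP // L2opE //; exact: semigroup_sqr_le.
move=> f e e0; have := sc (L2funP f).
have F0 (t : R) : 0 < t -> (0 <= L2norm m (semigroup p t f \- f)%R)%E.
  by move=> _; exact: Lnorm_ge0.
move=> /(ereal_cvg0P F0) /(_ e e0)[r r0 Hr]; exists r => // t /andP[].
rewrite le_eqVlt => /predU1P[<- _|t0 tr]; first by rewrite op0 ltW.
have := Hr t; rewrite t0 tr => /(_ isT).
have -> : (semigroup p t f \- f)%R = (L2op t f - f : L2fun m) :> (T -> R).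
  by rewrite -L2opE // ltW.
by rewrite L2norm_nrm lee_fin.
Qed.

Lemma L2_generatorP (f g : L2fun m) :
  L2_generator m p f g <-> generator (@L2ip _ _ _ m) L2op f g.
Proof.
have ipP := @L2ipP _ _ _ m.
have F0 (t : R) : 0 < t ->
    (0 <= L2norm m (fun x => t^-1 * (semigroup p t f x - f x) - g x)%R)%E.
  by move=> _; exact: Lnorm_ge0.
have E (t : R) : 0 < t ->
    L2norm m (fun x => t^-1 * (semigroup p t f x - f x) - g x) =
    (t^-1 * nrm (@L2ip _ _ _ m) (L2op t f - f - t *: g))%:E.
  move=> t0; rewrite -[t^-1]ger0_norm ?invr_ge0 ?(ltW t0) // -nrmZ //.
  rewrite scalerBr scalerA ger0_norm ?invr_ge0 ?(ltW t0) // mulVf ?gt_eqF //.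
  rewrite scale1r -L2norm_nrm -L2opE //; exact: ltW.
split=> [[_ _ /(ereal_cvg0P F0) H] e e0|H].
  have [r r0 Hr] := H e e0; exists r => // t tr; have := Hr t tr.
  have t0 : 0 < t by case/andP: tr.
  by rewrite E // lee_fin [t^-1 * _]mulrC ler_pdivrMr.
split; [exact: L2funP|exact: L2funP|apply/(ereal_cvg0P F0) => e e0].
have [r r0 Hr] := H e e0; exists r => // t tr; have := Hr t tr.
have t0 : 0 < t by case/andP: tr.
by rewrite E // lee_fin [t^-1 * _]mulrC ler_pdivrMr.
Qed.

Lemma L2op_one t : 0 <= t ->
  eqv (@L2ip _ _ _ m) (L2op t (L2one m)) (L2one m).
Proof.
move=> t0; apply: L2_ae_eqv; apply: aeW => x; rewrite L2opE // L2oneE //.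
rewrite /semigroup; under eq_Rintegral do rewrite L2oneE //.
by rewrite Rintegral_cst // prob_kernel mulr1.
Qed.

Lemma L2op_mean t (f : L2fun m) : 0 <= t ->
  L2ip (L2op t f) (L2one m) = L2ip f (L2one m).
Proof.
by move=> t0; rewrite !L2ip_one // L2opE // semigroup_mean // L2funP.
Qed.

Lemma L20P (f : L2fun m) : L20 m f <-> L2ip f (L2one m) = 0.
Proof.
have E c : L2inner m f (cst c) = c * L2ip f (L2one m).
  rewrite L2ip_one // -RintegralZl //; last exact: L2_integrable (L2funP f).
  by apply: eq_Rintegral => x _; rewrite mulrC.
split=> [[_ /(_ 1)]|f0]; first by rewrite E mul1r.
by split=> [|c]; [exact: L2funP|rewrite E f0 mulr0].
Qed.

Lemma relaxation_setP t : 0 <= t ->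
  (forall f, L20 m f -> (L2norm m (semigroup p t f)
      <= (expR (-1))%:E * L2norm m f)%E) <->
  (forall f : L2fun m, L2ip f (L2one m) = 0 ->
    nrm (@L2ip _ _ _ m) (L2op t f) <= expR (-1) * nrm (@L2ip _ _ _ m) f).
Proof.
move=> t0; have E (f : L2fun m) : (L2norm m (semigroup p t f)
      <= (expR (-1))%:E * L2norm m f)%E =
    (nrm (@L2ip _ _ _ m) (L2op t f) <= expR (-1) * nrm (@L2ip _ _ _ m) f).
  by rewrite -L2opE // !L2norm_nrm -EFinM lee_fin.
split=> H f; first by move=> /L20P /H; rewrite E.
by move=> f0; have := f0; case: f0 => hf _; rewrite -(toL2K hf) => /L20P /H;
  rewrite E.
Qed.

End L2_semigroup.

(** * Completeness of the space of square-integrable functions *)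

Section L2_completeness.
Context d (T : measurableType d) (R : realType).
Variable m : {measure set T -> \bar R}.
Hypothesis mT : m setT = 1%E.
Local Notation N := (nrm (@L2ip _ _ _ m)).

Lemma summable_increments_cvg (w : nat -> R) :
  (\sum_(k <oo) `|w k.+1 - w k|%:E < +oo)%E -> cvgn w.
Proof.
move=> S; have -> : w = (fun n => series (telescope w) n + w 0%N).
  by apply/funext => n; rewrite [LHS]eq_sum_telescope addrC.
apply: is_cvgD; last exact: is_cvg_cst.
apply: normed_cvg; apply: nondecreasing_is_cvgn.
  by apply: nondecreasing_series => n _ _; exact: normr_ge0.
exists (fine (\sum_(k <oo) `|w k.+1 - w k|%:E)%E) => _ [n _ <-].
have S0 : (0 <= \sum_(k <oo) `|w k.+1 - w k|%:E)%E by apply: nneseries_ge0.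
rewrite -lee_fin fineK ?ge0_fin_numE // /series /= -sumEFin.
exact: nneseries_lim_ge.
Qed.

Lemma L2_integral_abs_le (f : L2fun m) : (\int[m]_x `|f x|%:E <= (N f)%:E)%E.
Proof.
have mf := L2_measurable (L2funP f).
have af : (fun x => `|f x|) \in Lfun m 2%:E.
  apply: L2_sqr_integrable; first exact: measurableT_comp.
  under eq_integral => x _ do rewrite real_normK ?num_real //.
  by rewrite (L2_inner_sqr (L2funP f)) ltry.
have := ip_le (@L2ipP _ _ _ m) (toL2 m (fun x => `|f x|)) (L2one m).
rewrite (nrm_one (L2ip_one1 mT)) mulr1 L2ip_one //.
have -> : N (toL2 m (fun x => `|f x|)) = N f.
  rewrite /nrm /L2ip toL2K //; congr Num.sqrt; apply: eq_Rintegral => x _.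
  by rewrite -!expr2 real_normK ?num_real.
rewrite toL2K // -lee_fin /Rintegral fineK //.
exact: integrable_fin_num (L2_integrable mT af).
Qed.

Lemma L2_fast_cauchy_cvg (w : nat -> L2fun m) :
  (forall k, N (w k.+1 - w k) <= 1 / (2 ^ k.+1)%:R) ->
  {ae m, forall x, cvgn (fun k => w k x)}.
Proof.
move=> fast.
have mw k : measurable_fun setT (fun x => `|w k.+1 x - w k x|%:E).
  apply/measurable_EFinP; apply: measurableT_comp => //.
  exact: (L2_measurable (L2funP (w k.+1 - w k))).
have : m.-integrable setT (fun x => \sum_(k <oo) `|w k.+1 x - w k x|%:E)%E.
  apply/integrableP; split.
    exact: ge0_emeasurable_sum.
  under eq_integral do rewrite gee0_abs ?nneseries_ge0//.
  rewrite integral_nneseries //.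
  apply: (@le_lt_trans _ _ (\sum_(k <oo) (1 / (2 ^ k.+1)%:R)%:E)%E).
    apply: lee_nneseries => k _; first by move=> _; exact: integral_ge0.
    by apply: le_trans (L2_integral_abs_le (w k.+1 - w k)) _; rewrite lee_fin.
  by apply: le_lt_trans (epsilon_trick0 _ _) _; rewrite ?ltry.
move=> /(integrable_ae measurableT); apply: filterS => x /(_ I).
rewrite ge0_fin_numE ?nneseries_ge0 //; exact: summable_increments_cvg.
Qed.

(* Along a subsequence the increments are summable in L^1, hence almost
   everywhere; Fatou's lemma then gives convergence in L^2. *)
Lemma L2_complete (u : nat -> L2fun m) :
  (forall e : R, 0 < e -> exists k, forall i j, (k <= i)%N -> (k <= j)%N ->
     N (u i - u j) <= e) ->
  exists g, forall e : R, 0 < e -> exists k, forall i, (k <= i)%N ->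
    N (u i - g) <= e.
Proof.
move=> cauchy.
have : forall k, exists K, forall i j, (K <= i)%N -> (K <= j)%N ->
    N (u i - u j) <= 1 / (2 ^ k.+1)%:R.
  by move=> k; apply: cauchy; rewrite divr_gt0 // ltr0n expn_gt0.
move=> /choice[K HK].
(* The maximum over all [j <= k] puts both [phi k] and [phi k.+1] beyond [K k]; the inner [maxn _ j]
   makes [phi] unbounded. *)
pose phi k := (\max_(j < k.+1) maxn (K j) j)%N.
have phi_ge k j : (j <= k)%N -> (maxn (K j) j <= phi k)%N.
  move=> jk; exact: (leq_bigmax (Ordinal (jk : (j < k.+1)%N))).
pose w k := u (phi k).
have fast k : N (w k.+1 - w k) <= 1 / (2 ^ k.+1)%:R.
  by apply: HK; apply: leq_trans (leq_maxl _ k) (phi_ge _ _ _).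
have wcvg := L2_fast_cauchy_cvg fast.
(* The upper limit gives a representative that is defined and measurable everywhere; [fine] sends
   infinite values to 0, which matters on a null set only. *)
pose g x := fine (limn_esup (fun k => (w k x)%:E)).
have mg : measurable_fun setT g.
  apply: measurableT_comp => //; apply: measurable_fun_limn_esup => k.
  by apply/measurable_EFinP; exact: L2_measurable (L2funP (w k)).
have g_lim : {ae m, forall x, w k x @[k --> \oo] --> g x}.
  apply: filterS wcvg => x cw.
  have cE : (w k x)%:E @[k --> \oo] --> (limn (fun k => w k x))%:E.
    by apply: cvg_EFin => //; exact: nearW.
  by have [_] := cvg_limn_einf_sup cE; rewrite /g => ->.
have fatou_bound i (e : R) :
    (exists k0, forall n, N (w (n + k0)%N - u i) <= e) ->
    (\int[m]_x ((g x - u i x) ^+ 2)%:E <= (e ^+ 2)%:E)%E.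
  move=> [k0 Hk0].
  pose f n x := (((w (n + k0)%N - u i) x) ^+ 2)%:E.
  have mf n : measurable_fun setT (f n).
    apply/measurable_EFinP; apply: measurable_funX.
    exact: L2_measurable (L2funP _).
  have f0 n x : (0 <= f n x)%E by rewrite lee_fin sqr_ge0.
  have := fatou m measurableT mf (fun n x _ => f0 n x).
  have -> : (\int[m]_x limn_einf (f^~ x) = \int[m]_x ((g x - u i x) ^+ 2)%:E)%E.
    apply: ae_eq_integral => //.
    - rewrite /limn_einf; apply: measurableT_comp => //.
      by apply: measurable_fun_limn_esup => n; apply: measurableT_comp.
    - by apply/measurable_EFinP; apply: measurable_funX; exact: measurable_funB.
    apply: filterS g_lim => x gx _.
    have c : f n x @[n --> \oo] --> ((g x - u i x) ^+ 2)%:E.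
      apply: cvg_EFin => //; first exact: nearW.
      have -> : fine \o f^~ x = (fun n => (w (n + k0)%N x - u i x) ^+ 2).
        by [].
      apply: (@continuous_cvg _ _ _ _ _ _ (fun y : R => y ^+ 2)).
        exact: exprn_continuous.
      apply: cvgB; last exact: cvg_cst.
      by rewrite (cvg_shiftn k0 (fun n => w n x)).
    by have [-> _] := cvg_limn_einf_sup c.
  move=> /le_trans; apply; rewrite limn_einf_lim.
  apply: lime_le; first exact: is_cvg_einfs.
  apply: nearW => n; apply: (@le_trans _ _ (\int[m]_x f n x)%E).
    by apply: ereal_inf_lbound; exists n => /=.
  rewrite (L2_inner_sqr (L2funP (w (n + k0)%N - u i))) lee_fin.
  rewrite -[X in X <= _](nrm_sq (@L2ipP _ _ _ m)).
  by rewrite ler_pXn2r ?nnegrE ?nrm_ge0 // (le_trans _ (Hk0 0%N)) ?nrm_ge0.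
have shift (e : R) : 0 < e -> exists K0, forall i, (K0 <= i)%N ->
    exists k0, forall n, N (w (n + k0)%N - u i) <= e.
  move=> e0; have [K0 HK0] := cauchy _ e0.
  exists K0 => i K0i; exists K0 => n; apply: HK0 => //.
  apply: leq_trans (phi_ge _ _ (leqnn _)).
  by apply: leq_trans (leq_maxr _ _); exact: leq_addl.
have dL2 i (e : R) : (exists k0, forall n, N (w (n + k0)%N - u i) <= e) ->
    (fun x => g x - u i x) \in Lfun m 2%:E.
  move=> /fatou_bound H; apply: L2_sqr_integrable.
    by apply: measurable_funB => //; exact: L2_measurable (L2funP (u i)).
  by apply: le_lt_trans H _; rewrite ltry.
have gL2 : g \in Lfun m 2%:E.
  have [K0 HK0] := shift 1 ltr01.
  have h := dL2 _ _ (HK0 K0 (leqnn _)).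
  suff -> : g = (toL2 m (fun x => g x - u K0 x)%R + u K0 : L2fun m) :> (T -> R).
    exact: L2funP.
  apply/funext => x.
  rewrite [RHS](_ : _ = toL2 m (fun x => g x - u K0 x) x + u K0 x) //.
  by rewrite toL2K // subrK.
exists (toL2 m g) => e e0; have [K0 HK0] := shift e e0; exists K0 => i K0i.
have H := fatou_bound _ _ (HK0 i K0i).
rewrite (nrmB (@L2ipP _ _ _ m)) -(@ler_pXn2r _ 2) ?nnegrE ?nrm_ge0 ?(ltW e0) //.
rewrite (nrm_sq (@L2ipP _ _ _ m)) -lee_fin -L2_inner_sqr ?L2funP //.
apply: le_trans H; rewrite le_eqVlt; apply/orP; left; apply/eqP.
apply: eq_integral => x _.
congr ((_ ^+ 2)%:E).
by rewrite [LHS](_ : _ = toL2 m g x - u i x) // toL2K.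
Qed.

End L2_completeness.
(** * Relaxation time of a second-order lift *)

Lemma reversible_invariant d (S : measurableType d) (R : realType)
    (mu : {measure set S -> \bar R}) (p : R -> R.-pker S ~> S) :
  reversible_measure mu p -> invariant_measure mu p.
Proof.
move=> rev t t0 A mA; rewrite (rev t t0 setT A) //.
under eq_integral do rewrite prob_kernel.
by rewrite integral_cst // mul1e.
Qed.

Section first_projection.
Context dS dV (S : measurableType dS) (V : measurableType dV) (R : realType).
Variables (mu : probability S R) (kappa : probability V R).
Local Notation muh := (mu \x kappa)%E.

Lemma ge0_integral_fst (F : S -> \bar R) : measurable_fun setT F ->
  (forall x, 0 <= F x)%E -> (\int[muh]_x F x.1 = \int[mu]_x F x)%E.
Proof.
move=> mF F0; rewrite (fubini_tonelli1 (F \o fst)) //=; last first.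
  by apply: measurableT_comp.
apply: eq_integral => x _; rewrite /fubini_F /= integral_cst //.
by rewrite [X in (_ * X)%E](_ : _ = 1%E) ?mule1 //; exact: probability_setT.
Qed.

Lemma Rintegral_fst (f : S -> R) : measurable_fun setT f ->
  \int[muh]_x f x.1 = \int[mu]_x f x.
Proof.
move=> /measurable_EFinP mf; congr fine; rewrite integralE [RHS]integralE.
have := ge0_integral_fst (measurable_funepos mf) (funepos_ge0 _).
have := ge0_integral_fst (measurable_funeneg mf) (funeneg_ge0 _).
by move=> <- <-; congr (_ - _)%E; apply: eq_integral => x _;
  rewrite ?funeposE ?funenegE.
Qed.

Lemma L2_fst (f : S -> R) : f \in Lfun mu 2%:E -> f \o fst \in Lfun muh 2%:E.
Proof.
move=> hf; have mf := L2_measurable hf; apply: L2_sqr_integrable.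
  exact: measurableT_comp.
rewrite (ge0_integral_fst (F := fun x => (f x ^+ 2)%:E)).
- by rewrite (L2_inner_sqr hf) ltry.
- by apply/measurable_EFinP; exact: measurable_funX.
- by move=> x; rewrite lee_fin sqr_ge0.
Qed.

End first_projection.

Section lift.
Context (dS dV : measure_display)
  (S : measurableType dS) (V : measurableType dV) (R : realType).
Variables (mu : probability S R) (kappa : probability V R).
Variables (p : R -> R.-pker S ~> S)
  (ph : R -> R.-pker (S * V)%type ~> (S * V)%type).
Hypotheses (tp : transition_function p) (inv : invariant_measure mu p)
  (sc : strongly_continuous mu p) (tph : transition_function ph)
  (invh : invariant_measure (mu \x kappa)%E ph)
  (sch : strongly_continuous (mu \x kappa)%E ph)
  (lift : second_order_lift mu kappa p ph).
Local Notation muh := (mu \x kappa)%E.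

Let mT : mu setT = 1%E. Proof. exact: probability_setT. Qed.
Let mhT : muh setT = 1%E. Proof. exact: probability_setT. Qed.

Lemma lift_relaxation_le (t : R) : 0 <= t ->
  (forall f, L20 muh f -> (L2norm muh (semigroup ph t f)
      <= (expR (-1))%:E * L2norm muh f)%E) ->
  (relaxation_time mu p <= (2 * t ^+ 2 / (1 - expR (-1)) ^+ 2)%:E)%E.
Proof.
move=> t0 relax; set K := 2 * _ / _.
have K0 : 0 <= K by rewrite divr_ge0 ?sqr_ge0 // mulr_ge0 ?sqr_ge0.
apply: ereal_inf_lbound; exists K => //; split => //.
apply/(relaxation_setP mT inv K0).
move: relax => /(relaxation_setP mhT invh t0) relax.
have [C [[_ _ core] liftC liftE]] := lift.
pose J (f : L2fun mu) : L2fun muh := toL2 muh (f \o fst).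
have JE f : J f = f \o fst :> (S * V -> R).
  by rewrite /J toL2K //; apply: L2_fst; exact: L2funP.
apply: (@lift_relaxation _ _ _ (@L2ip _ _ _ mu) (@L2ip _ _ _ muh)
  (@L2op _ _ _ mu p) (@L2op _ _ _ muh ph)
  (L2one mu) (L2one muh) J (fun f => C (f : S -> R)) t) => //.
- exact: L2ipP.
- exact: L2ipP.
- exact: L2op_csg.
- exact: L2op_csg.
- exact: L2ip_one1.
- exact: L2ip_one1.
- by move=> s s0; exact: L2op_one.
- by move=> s s0; exact: L2op_one.
- by move=> s f s0; exact: L2op_mean.
- move=> f; rewrite /L2ip /L2inner JE.
  by rewrite -(Rintegral_fst mu kappa (f := fun x => f x * f x)) //;
    exact: measurable_funM.
- by move=> f; rewrite !L2ip_one // JE Rintegral_fst.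
- move=> f e e0; apply: domain_dense => //; first exact: L2ipP.
    exact: L2op_csg.
  exact: L2_complete.
- move=> f g /(L2_generatorP inv) fg e e0.
  have [f' [g' [Cf' fg' ff' gg']]] := core _ _ fg e e0.
  have [hf' hg' _] := fg'.
  have close (u : S -> R) (v : L2fun mu) : u \in Lfun mu 2%:E ->
      (L2norm mu (u \- v)%R < e%:E)%E ->
        nrm (@L2ip _ _ _ mu) (toL2 mu u - v) <= e.
    move=> hu; have -> : (u \- v)%R = (toL2 mu u - v : L2fun mu) :> (S -> R).
      by apply/funext => x; rewrite -{1}(toL2K hu).
    by rewrite L2norm_nrm lte_fin => /ltW.
  exists (toL2 mu f'), (toL2 mu g'); split; first by rewrite toL2K.
  + by apply/(L2_generatorP inv); rewrite !toL2K.
  + exact: close.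
  + exact: close.
- move=> f g Cf /(L2_generatorP inv) fg.
  have [F hF] := liftC _ Cf; have [_ hF2 _] := hF.
  (* On the diagonal the lift identity reads [|F|^2 / 2 = - <f, L f>]. *)
  have [_ FF] := liftE _ _ _ _ _ Cf Cf fg hF hF.
  exists (toL2 muh F); last by rewrite /L2ip !toL2K.
  by apply/(L2_generatorP invh); rewrite JE toL2K.
Qed.

Lemma lift_relaxation_time :
  (((1 - expR (-1)) / Num.sqrt 2)%:E * sqrte (relaxation_time mu p)
     <= relaxation_time muh ph)%E.
Proof.
apply: le_ereal_inf_tmp => _ [t [t0 relax] <-].
have a0 : 0 < 1 - expR (-1) :> R by rewrite subr_gt0 expR_lt1 // ltrN10.
have s2 : 0 < Num.sqrt 2 :> R by rewrite sqrtr_gt0.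
(* The bound [K = 2 t^2 / (1 - e^-1)^2] is inverted: its square root times [(1 - e^-1) / sqrt 2] is
   [t]. *)
apply: le_trans (_ : _ <= ((1 - expR (-1)) / Num.sqrt 2)%:E *
    sqrte (2 * t ^+ 2 / (1 - expR (-1)) ^+ 2)%:E)%E _.
  apply: lee_wpmul2l; first by rewrite lee_fin divr_ge0 // ltW.
  rewrite lee_sqrt; first exact: lift_relaxation_le.
  by rewrite lee_fin divr_ge0 ?sqr_ge0 // mulr_ge0 ?sqr_ge0.
rewrite /= -EFinM lee_fin sqrtrM ?mulr_ge0 ?sqr_ge0 // sqrtrM // sqrtr_sqr.
rewrite -exprVn sqrtr_sqr !ger0_norm ?invr_ge0 ?(ltW a0) //.
by rewrite le_eqVlt; apply/orP; left; apply/eqP; field; rewrite !gt_eqF.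
Qed.

End lift.
(** * Gaussian measure on centred profiles *)

Lemma sin_le_id (R : realType) (x : R) : 0 <= x -> sin x <= x.
Proof.
move=> x0; have [|c _] :=
  @MVT_segment R sin cos 0 x x0 (fun y _ => is_derive_sin y).
  by apply: continuous_subspaceT; exact: continuous_sin.
by rewrite sin0 !subr0 => ->; rewrite ler_piMl // cos_le1.
Qed.

Section eigenvector.
Variables (R : realType) (n : nat).
Hypothesis n2 : (2 <= n)%N.

Let theta : R := 2 * pi / n%:R.
(** The Fourier mode of lowest frequency with a free phase, defined on naturals; periodicity
    ([u_mod]) carries it to the cycle, so the wrap-around needs no case distinction. *)
Let u (phi : R) (k : nat) : R := cos (theta * k%:R - phi).

Let n0 : 0 < n%:R :> R. Proof. by rewrite ltr0n (leq_trans _ n2). Qed.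

Lemma ZnE : (Zp_trunc n).+2 = n. Proof. exact: Zp_cast. Qed.

Let u_mod phi k : u phi (k %% n) = u phi k.
Proof.
rewrite [in RHS](divn_eq k n); elim: (k %/ n)%N => [|q IH] //.
rewrite mulSn -addnA [LHS]IH; set m := (_ + _)%N; rewrite /u.
have -> : theta * (n + m)%:R - phi = theta * m%:R - phi + pi *+ 2.
  by rewrite natrD -mulr_natl /theta; field; rewrite gt_eqF.
by rewrite cosD2pi.
Qed.

Let val_succ (i : 'Z_n) : (i + 1)%R = (i.+1 %% n)%N :> nat.
Proof.
transitivity (i.+1 %% (Zp_trunc n).+2)%N; first by rewrite /= modnDmr addn1.
by congr (_ %% _)%N; exact: ZnE.
Qed.

Let lam : R := 2 - 2 * cos theta.

Let u_eigen phi (i : 'Z_n) :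
  2 * u phi i - u phi (i + 1)%R - u phi (i - 1)%R = lam * u phi i.
Proof.
set j := i - 1; have -> : i = j + 1 by rewrite subrK.
have -> : u phi (j + 1)%R = u phi j.+1 by rewrite val_succ u_mod.
have -> : u phi (j + 1 + 1)%R = u phi j.+2.
  by rewrite !val_succ u_mod -addn1 -u_mod modnDml u_mod addn1.
have E (k : nat) : u phi k.+1 = cos (theta * k%:R - phi + theta).
  by rewrite /u -natr1 mulrDr mulr1 addrAC.
rewrite (E j.+1).
have -> : u phi j = cos (theta * j.+1%:R - phi - theta).
  by rewrite /u -natr1; congr cos; ring.
rewrite /u /lam; move: (theta * j.+1%:R - phi) => x; rewrite cosD cosB; ring.
Qed.

Lemma sum_shift (f : 'Z_n -> R) (a : 'Z_n) : \sum_i f (i + a) = \sum_i f i.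
Proof. by rewrite [RHS](reindex_inj (addIr a)). Qed.

(* [c] is one of the cosine and the sine: their squared norms add up to [n]. *)
Lemma discrete_eigenvector : exists (c : 'Z_n -> R) (l : R),
  [/\ forall i, `|c i| <= 1, \sum_i c i = 0,
      forall i, 2 * c i - c (i + 1) - c (i - 1) = l * c i,
      0 < l <= 4 * pi ^+ 2 / n%:R ^+ 2 &
      n%:R / 2 <= \sum_i c i ^+ 2].
Proof.
have lamE : lam = 4 * sin (pi / n%:R) ^+ 2.
  rewrite /lam (_ : theta = (pi / n%:R) *+ 2); last first.
    by rewrite /theta -[RHS]mulr_natl mulrA.
  by rewrite cos_mulr2n cos2sin2; ring.
have s0 : 0 < sin (pi / n%:R :> R).
  rewrite sin_gt0_pi // divr_gt0 ?pi_gt0 //= ltr_pdivrMr // ltr_pMr ?pi_gt0 //.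
  by rewrite ltr1n.
have lam0 : 0 < lam by rewrite lamE mulr_gt0 // exprn_gt0.
have lam1 : lam <= 4 * pi ^+ 2 / n%:R ^+ 2.
  rewrite lamE -mulrA ler_pM2l // -expr_div_n ler_pXn2r ?nnegrE ?(ltW s0) //.
    by rewrite sin_le_id // divr_ge0 ?pi_ge0 // ltW.
  by rewrite divr_ge0 ?pi_ge0 // ltW.
have [phi Hphi] : exists phi, n%:R / 2 <= \sum_(i : 'Z_n) u phi i ^+ 2.
  have S : \sum_(i : 'Z_n) u 0 i ^+ 2 + \sum_(i : 'Z_n) u (pi / 2) i ^+ 2 =
      n%:R.
    rewrite -big_split /= (eq_bigr (fun=> 1)) => [|i _].
      by rewrite sumr_const card_ord ZnE.
    by rewrite /u subr0 cosBpihalf cos2Dsin2.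
  have [h|h] := leP (n%:R / 2) (\sum_(i : 'Z_n) u 0 i ^+ 2).
    by exists 0.
  by exists (pi / 2); move: h S; lra.
exists (fun i => u phi i), lam; split=> //.
- by move=> i; exact: cos_max.
(* Summed over the cycle, the left side of the eigenvalue equation vanishes. *)
- have : lam * \sum_(i : 'Z_n) u phi i = 0.
    rewrite mulr_sumr -(eq_bigr _ (fun i _ => u_eigen phi i)) !sumrB -mulr_sumr.
    rewrite (sum_shift (fun i => u phi i)) (sum_shift (fun i => u phi i)); ring.
  by move=> /eqP; rewrite mulf_eq0 gt_eqF //= => /eqP.
- by rewrite lam0.
Qed.

End eigenvector.

(** * Coordinates, linear functionals and energy of profiles *)

Section profile_measurability.
Variables (R : realType) (n : nat).
Implicit Types (l h : profile R n) (i : 'Z_n) (c : 'Z_n -> R).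

Lemma profile_coordD i l h :
  profile_coord i (l + h) = profile_coord i l + profile_coord i h.
Proof. by rewrite /profile_coord [pval _](_ : _ = pval l + pval h) // mxE. Qed.

Lemma profile_coordZ i (a : R) l :
  profile_coord i (a *: l) = a * profile_coord i l.
Proof. by rewrite /profile_coord [pval _](_ : _ = a *: pval l) // mxE. Qed.

Lemma profile_coord_sum l : \sum_i profile_coord i l = 0.
Proof. by case: l => l lP; exact/eqP. Qed.

Lemma measurable_profile_coord i :
  measurable_fun setT (@profile_coord R n i).
Proof.
move=> _ Y mY; rewrite setTI; apply: sub_sigma_algebra => /=.
rewrite -bigcup_seq /=; exists i => /=; first by rewrite mem_index_enum.
by exists Y => //; rewrite setTI.
Qed.

Lemma measurable_fun_profile d (T : measurableType d) (f : T -> profile R n) :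
  (forall i, measurable_fun setT (fun x => profile_coord i (f x))) ->
  measurable_fun setT f.
Proof.
move=> mf; suff : g_sigma_preimage
    (fun i : 'Z_n => (@profile_coord R n i : _ -> measurableTypeR R) \o f)
      `<=` measurable.
  rewrite g_sigma_preimage_comp => prefS _ A mA.
  by apply: prefS; exists A.
apply: smallest_sub; first exact: sigma_algebra_measurable.
rewrite -bigcup_mkord_ord; apply: bigcup_sub => i Ii.
by move=> A [B mB <-]; exact: mf.
Qed.

Lemma measurable_profile_shift h : measurable_fun setT (fun l => l + h).
Proof.
apply: measurable_fun_profile => i.
under eq_fun do rewrite profile_coordD.
by apply: measurable_funD => //; exact: measurable_profile_coord.
Qed.

Definition pairing c l : R := \sum_i c i * profile_coord i l.

Lemma measurable_pairing c : measurable_fun setT (pairing c).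
Proof.
apply: measurable_sum => i; apply: measurable_funM => //.
exact: measurable_profile_coord.
Qed.

Lemma pairingD c l h : pairing c (l + h) = pairing c l + pairing c h.
Proof.
rewrite -big_split /=; apply: eq_bigr => i _.
by rewrite profile_coordD mulrDr.
Qed.

Lemma pairingZ c (a : R) l : pairing c (a *: l) = a * pairing c l.
Proof.
rewrite mulr_sumr; apply: eq_bigr => i _.
by rewrite profile_coordZ mulrCA.
Qed.

Lemma pairingN c l : pairing (fun i => - c i) l = - pairing c l.
Proof. by rewrite -sumrN; apply: eq_bigr => i _; rewrite mulNr. Qed.

Lemma slopeD l h i : slope (l + h) i = slope l i + slope h i.
Proof. by rewrite /slope !profile_coordD; ring. Qed.

Lemma slopeZ (a : R) l i : slope (a *: l) i = a * slope l i.
Proof. by rewrite /slope !profile_coordZ mulrBr. Qed.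

Lemma measurable_energy : measurable_fun setT (@energy R n).
Proof.
apply: measurable_sum => i; apply: measurable_funX; apply: measurable_funB;
  exact: measurable_profile_coord.
Qed.

End profile_measurability.

(** * Translations of the Gaussian measure along an eigenvector *)

Section gaussian_shift.
Variables (R : realType) (n : nat) (c : 'Z_n -> R) (lambda : R).
Hypotheses (c_sum : \sum_i c i = 0)
  (c_eigen : forall i, 2 * c i - c (i + 1) - c (i - 1) = lambda * c i)
  (lambda0 : 0 <= lambda).
Variable mu : {measure set (profile R n) -> \bar R}.
Hypothesis gmu : gaussian_profile mu.
Implicit Types (l : profile R n) (a M : R) (A : set (profile R n)).

Let c_centred : \row_(j < _) c j \in @centred R n.
Proof. by rewrite inE; apply/eqP; under eq_bigr do rewrite mxE. Qed.

Definition eigenprofile : profile R n := Profile c_centred.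

Let v_coord i : profile_coord i eigenprofile = c i.
Proof. by rewrite /profile_coord /= mxE. Qed.

Lemma pairing_eigenprofile : pairing c eigenprofile = \sum_i c i ^+ 2.
Proof. by apply: eq_bigr => i _; rewrite v_coord expr2. Qed.

(** Summation by parts on the cycle, then the eigenvalue equation. *)
Lemma slope_eigenprofile l :
  \sum_i slope l i * slope eigenprofile i = lambda * pairing c l.
Proof.
pose x i := profile_coord i l.
transitivity (\sum_i x (i + 1) * (c (i + 1) - c (i + 1 - 1))
    - \sum_i x i * (c (i + 1) - c i)).
  rewrite -sumrB; apply: eq_bigr => i _.
  by rewrite /slope !v_coord -/(x i) -/(x (i + 1)) addrK; ring.
rewrite (sum_shift (fun i => x i * (c i - c (i - 1))) 1) -sumrB mulr_sumr.
apply: eq_bigr => i _; rewrite mulrA -c_eigen -/(x i); ring.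
Qed.

Lemma energy_shift a l :
  energy (l + a *: eigenprofile) = energy l + 2 * a * lambda * pairing c l
    + a ^+ 2 * lambda * \sum_i c i ^+ 2.
Proof.
rewrite -pairing_eigenprofile -!mulrA -!slope_eigenprofile !mulr_sumr.
rewrite /energy -!big_split /=; apply: eq_bigr => i _.
by rewrite slopeD slopeZ; ring.
Qed.

(** Cameron-Martin: by translation invariance of the reference measure, moving [A] by [a c]
    multiplies the density at [l] by [exp (- a lambda G(l) - a^2 lambda |c|^2 / 2)], which is
    bounded below where [|G| <= M]. *)
Lemma gaussian_shift_ge a M A : measurable A ->
    (forall l, A l -> `|pairing c l| <= M) ->
  ((expR (- (`|a| * lambda * M + a ^+ 2 * lambda * (\sum_i c i ^+ 2) / 2)))%:E
     * mu A <= mu [set l | A (l - a *: eigenprofile)%R])%E.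
Proof.
move=> mA AM; have [lam [Z [[lam_inv _] Z0 muE]]] := gmu.
set q := expR _; set v := a *: eigenprofile; set B := [set l | _].
pose phi (l : profile R n) : \bar R := (expR (- 2^-1 * energy l) / Z)%:E.
have mphi : measurable_fun setT phi.
  apply/measurable_EFinP; apply: measurable_funM => //.
  apply: measurableT_comp => //; apply: measurable_funM => //.
  exact: measurable_energy.
have phi0 l : (0 <= phi l)%E by rewrite lee_fin divr_ge0 ?expR_ge0 // ltW.
have mshift h := @measurable_profile_shift R n h.
have mB : measurable B by rewrite -[B]setTI; exact: mshift.
have shiftB : (fun l => l + v) @^-1` B = A.
  by apply/seteqP; split => l; rewrite /B /= addrK.
have {}muE D : measurable D -> mu D = (\int[lam]_(l in D) phi l)%E := muE D.
rewrite !muE //.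
have -> : (\int[lam]_(l in B) phi l = \int[lam]_(l in A) phi (l + v)%R)%E.
  transitivity (\int[pushforward lam (fun l => l + v)%R]_(l in B) phi l)%E.
    apply: eq_measure_integral => D mD _.
    by rewrite /pushforward; apply/esym; exact: lam_inv.
  rewrite ge0_integral_pushforward ?shiftB //.
  exact: measurable_funTS.
rewrite -ge0_integralZl ?lee_fin ?expR_ge0 //; last exact: measurable_funTS.
apply: ge0_le_integral => //.
- by move=> l _; rewrite mule_ge0 // lee_fin expR_ge0.
- by apply: measurable_funTS; exact: measurable_funeM.
- by apply: measurable_funTS; exact: measurableT_comp.
move=> l Al; rewrite /phi -EFinM lee_fin mulrA ler_wpM2r ?invr_ge0 ?(ltW Z0) //.
rewrite -expRD ler_expR energy_shift.
have /ler_normlP[G1 G2] := AM _ Al.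
have : a * pairing c l <= `|a| * M.
  apply: le_trans (ler_norm _) _; rewrite normrM ler_wpM2l //.
  exact: AM.
move=> /(ler_wpM2l lambda0); lra.
Qed.

End gaussian_shift.

(** * Tails of one Gaussian functional *)

Section gaussian_tail.
Variables (R : realType) (n : nat) (c : 'Z_n -> R) (lambda : R).
Hypotheses (c_sum : \sum_i c i = 0)
  (c_eigen : forall i, 2 * c i - c (i + 1) - c (i - 1) = lambda * c i)
  (lambda0 : 0 <= lambda) (c2 : 0 < \sum_i c i ^+ 2).
Variable mu : probability (profile R n) R.
Hypothesis gmu : gaussian_profile mu.
Local Notation S := (\sum_i c i ^+ 2).
Local Notation G := (pairing c).

Lemma measurable_pairing_preimage (Y : set R) : measurable Y ->
  measurable (G @^-1` Y).
Proof.
by move=> mY; rewrite -[X in measurable X]setTI; exact: measurable_pairing.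
Qed.

Let pairing_shift a l :
  G (l - a *: eigenprofile c_sum) = G l - a * S.
Proof.
by rewrite -scaleNr pairingD pairingZ pairing_eigenprofile mulNr.
Qed.

(* Translating by [T / S] times [eigenprofile] raises [G] by [T]; on
   [{0 <= G <= T}] it costs at most a factor [exp (- (3/2) T^2 lambda / S)]. *)
Lemma gaussian_tail_ge (T : R) (D : set (profile R n)) : 0 < T ->
    T ^+ 2 * lambda <= S -> measurable D ->
    (forall l, D l -> 0 <= G l) -> (forall l, T <= G l -> D l) ->
  expR (- (3 / 2)) * fine (mu D)
    <= (1 + expR (- (3 / 2))) * fine (mu (G @^-1` `[T, +oo[)).
Proof.
(* [D] is only sandwiched between [{G >= T}] and [{G >= 0}], which covers closed and open
   half-spaces alike; [A] is the part of [D] that the translation pushes into [{G >= T}]. *)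
move=> T0 TS mD D0 DT; pose A := D `&` G @^-1` `]-oo, T[.
have mA : measurable A by apply: measurableI => //;
  exact: measurable_pairing_preimage.
set B := G @^-1` _.
have mB : measurable B by exact: measurable_pairing_preimage.
have AT l : A l -> `|G l| <= T.
  by move=> [/D0 Gl]; rewrite /= in_itv /= => /ltW; rewrite ger0_norm.
have := gaussian_shift_ge c_sum c_eigen lambda0 gmu (T / S) mA AT.
set q' := expR _; set q := expR (- (3 / 2)).
have qq' : q <= q'.
  rewrite ler_expR lerN2 ger0_norm ?divr_ge0 ?(ltW T0) ?(ltW c2) //.
  have -> : T / S * lambda * T + (T / S) ^+ 2 * lambda * S / 2 =
      3 / 2 * (T ^+ 2 * lambda / S) by field; rewrite gt_eqF.
  by rewrite ler_piMr // ler_pdivrMr // mul1r.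
set A' := [set l | _] => H.
have mA' : measurable A'.
  by rewrite -[A']setTI; exact: measurable_profile_shift.
have A'B : A' `<=` B.
  move=> l [/D0 + _]; rewrite pairing_shift divfK ?gt_eqF // subr_ge0 /B /=.
  by rewrite in_itv /= andbT.
have {H} : q * fine (mu A) <= fine (mu B).
  rewrite -lee_fin EFinM !fineK ?fin_num_measure //.
  apply: le_trans (le_measure mu _ _ A'B); rewrite ?inE //.
  by apply: le_trans H; apply: lee_wpmul2r => //; rewrite lee_fin.
have -> : fine (mu D) = fine (mu A) + fine (mu B).
  rewrite -fineD ?fin_num_measure // -measureU //.
    congr (fine (mu _)); apply/seteqP; split => [l Dl|l [[]//|]].
      have [TG|GT] := leP T (G l); [right|left].
        by rewrite /B /= in_itv /= andbT.
      by split => //; rewrite /= in_itv.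
    by rewrite /B /= in_itv /= andbT; exact: DT.
  apply/seteqP; split => // l [[_]]; rewrite /B /= !in_itv /= andbT => h1 h2.
  by have := lt_le_trans h1 h2; rewrite ltxx.
rewrite mulrDr mulrDl mul1r lerD2r; exact.
Qed.

(** Translation by [(k + 1) / S] takes the slab [|G| <= k] into [{G >= 1}], hence into [D]. If [D]
    were null, all these slabs would be, and they exhaust the space. *)
Lemma gaussian_halfspace_gt0 (D : set (profile R n)) : measurable D ->
  (forall l, 1 <= G l -> D l) -> 0 < fine (mu D).
Proof.
move=> mD DG; rewrite fine_gt0 // ltey_eq fin_num_measure //= andbT.
rewrite lt0e measure_ge0 andbT; apply/negP => /eqP D0.
pose A (k : nat) := G @^-1` `[- k%:R, k%:R].
have mA k : measurable (A k) by exact: measurable_pairing_preimage.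
have A0 k : mu (A k) = 0%E.
  have Ak l : A k l -> `|G l| <= k%:R by rewrite /A /= in_itv /= ler_norml.
  have := gaussian_shift_ge c_sum c_eigen lambda0 gmu ((k%:R + 1) / S) (mA k)
    Ak.
  set q := expR _; set A' := [set l | _] => H.
  have mA' : measurable A'.
    by rewrite -[A']setTI; exact: measurable_profile_shift.
  have A'D : A' `<=` D.
    move=> l; rewrite /A' /A /= in_itv /= pairing_shift divfK ?gt_eqF //.
    by move=> /andP[h _]; apply: DG; move: h; lra.
  have A'0 : mu A' = 0%E by exact: (subset_measure0 mA' mD A'D D0).
  have {}H : (q%:E * mu (A k) <= 0)%E by rewrite -A'0.
  by apply/eqP;
    rewrite -measure_le0 -(pmule_rle0 _ (_ : 0 < q%:E)%E) // lte_fin expR_gt0.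
have : mu (\bigcup_k A k) = 0%E.
  apply: measure_negligible; first exact: bigcupT_measurable.
  by apply: negligible_bigcup => k; apply/negligibleP => //; exact: A0.
have -> : \bigcup_k A k = setT.
  apply/seteqP; split => // l _; exists (Num.truncn `|G l|).+1 => //.
  by rewrite /A /= in_itv /= -ler_norml ltW // truncnS_gt.
by rewrite probability_setT => /eqP; rewrite onee_eq0.
Qed.

End gaussian_tail.
(** * The self-repellent random walk *)

Section srrw_process.
Context d (Om : measurableType d) (R : realType) (n : nat).
Variables (P : profile R n * 'Z_n -> probability Om R)
  (cL : R -> Om -> profile R n) (X : R -> Om -> 'Z_n).
Hypotheses (n2 : (2 <= n)%N) (rw : srrw P cL X).

(** Read off from the centring of the profiles at times 0 and [t] rather than from the integrals. *)
Lemma sum_local_time (w : Om) (t : R) : 0 <= t ->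
  \sum_(i : 'Z_n) local_time X i t w = t.
Proof.
move=> t0; have := profile_coord_sum (cL t w).
under eq_bigr do rewrite (srrw_local_time rw) //.
rewrite sumrB big_split /= profile_coord_sum add0r sumr_const card_ord.
have -> : t / n%:R *+ (Zp_trunc n).+2 = t.
  by rewrite ZnE // -mulr_natr divfK // pnatr_eq0 -lt0n ltnW.
by move=> /eqP; rewrite subr_eq0 => /eqP.
Qed.

Lemma pairing_displacement (c : 'Z_n -> R) (w : Om) (t : R) : 0 <= t ->
    \sum_i c i = 0 -> (forall i, `|c i| <= 1) ->
  `|pairing c (cL t w) - pairing c (cL 0 w)| <= t.
Proof.
move=> t0 c0 c1.
have -> : pairing c (cL t w) - pairing c (cL 0 w) =
    \sum_i c i * local_time X i t w.
  (* The drift [t / n] is invisible to [c], whose entries sum to 0. *)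
  have cZ : \sum_i c i * (t / n%:R) = 0 by rewrite -mulr_suml c0 mul0r.
  rewrite -[RHS]subr0 -[X in _ = _ - X]cZ /pairing -!sumrB.
  by apply: eq_bigr => i _; rewrite (srrw_local_time rw) //; ring.
rewrite -[leRHS](sum_local_time w t0).
apply: le_trans (ler_norm_sum _ _ _) _; apply: ler_sum => i _.
have LT0 : 0 <= local_time X i t w.
  by apply: Rintegral_ge0 => s _; rewrite indicE.
by rewrite normrM (ger0_norm LT0) ler_piMl.
Qed.

Lemma transition_null (p : R -> R.-pker (profile R n * 'Z_n)%type
                  ~> (profile R n * 'Z_n)%type) t x A :
    transition_of P (fun t w => (cL t w, X t w)) p -> 0 <= t -> measurable A ->
    (forall w, (cL 0 w, X 0 w) = x -> ~ A (cL t w, X t w)) ->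
  p t x A = 0%E.
Proof.
move=> pP t0 mA NA; rewrite pP //.
apply: measure_negligible.
  have [mL mX] := srrw_measurable rw t0.
  rewrite -[X in measurable X]setTI.
  by apply: measurable_fun_pair.
have := srrw_start rw x; apply: negligibleS => w /= Aw.
by move=> /NA; exact.
Qed.

End srrw_process.

(** * A test function that the walk leaves unchanged for a long time *)

Section relaxation_bound.
Context d (Om : measurableType d) (R : realType) (n : nat).
Variables (mu : probability (profile R n) R) (kappa : probability 'Z_n R)
  (P : profile R n * 'Z_n -> probability Om R)
  (cL : R -> Om -> profile R n) (X : R -> Om -> 'Z_n)
  (ph : R -> R.-pker (profile R n * 'Z_n)%type ~> (profile R n * 'Z_n)%type).
Hypotheses (n2 : (2 <= n)%N) (gmu : gaussian_profile mu) (rw : srrw P cL X)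
  (phP : transition_of P (fun t w => (cL t w, X t w)) ph).
Local Notation muh := (mu \x kappa)%E.

Variables (c : 'Z_n -> R) (lambda T : R).
Hypotheses (c_sum : \sum_i c i = 0) (c1 : forall i, `|c i| <= 1)
  (c_eigen : forall i, 2 * c i - c (i + 1) - c (i - 1) = lambda * c i)
  (lambda0 : 0 <= lambda) (c2 : 0 < \sum_i c i ^+ 2)
  (T0 : 0 < T) (TS : T ^+ 2 * lambda <= \sum_i c i ^+ 2).
Local Notation G := (pairing c).

Let A := G @^-1` `[0, +oo[.
Let B := G @^-1` `]-oo, 0[.
Let Ap := G @^-1` `[T, +oo[.
Let Bm := (pairing (fun i => - c i)) @^-1` `[T, +oo[.
(** The two masses stay parameters: the centred function with values [b] and [- a] has variance
    [a * b], and the tail bounds are linear in each mass. *)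
Let a : R := fine (mu A).
Let b : R := fine (mu B).

Let mA : measurable A. Proof. exact: measurable_pairing_preimage. Qed.
Let mB : measurable B. Proof. exact: measurable_pairing_preimage. Qed.
Let mAp : measurable Ap. Proof. exact: measurable_pairing_preimage. Qed.
Let mBm : measurable Bm. Proof. exact: measurable_pairing_preimage. Qed.

(** [- c] is an eigenvector for the same eigenvalue, so the lower tail of [G] is an upper tail for
    [- c]. *)
Let Nc_sum : \sum_i - c i = 0. Proof. by rewrite sumrN c_sum oppr0. Qed.
Let Nc_eigen i : 2 * - c i - - c (i + 1) - - c (i - 1) = lambda * - c i.
Proof. by rewrite [RHS]mulrN -c_eigen; ring. Qed.
Let Nc2 : \sum_i (- c i) ^+ 2 = \sum_i c i ^+ 2.
Proof. by apply: eq_bigr => i _; rewrite sqrrN. Qed.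

Let a_gt0 : 0 < a.
Proof.
apply: (gaussian_halfspace_gt0 c_sum c_eigen lambda0 c2 gmu mA) => l Gl.
by rewrite /A /= in_itv /= andbT (le_trans ler01).
Qed.

Let b_gt0 : 0 < b.
Proof.
have c2' : 0 < \sum_i (- c i) ^+ 2 by rewrite Nc2.
apply: (gaussian_halfspace_gt0 Nc_sum Nc_eigen lambda0 c2' gmu mB) => l.
by rewrite pairingN /B /= in_itv /=; lra.
Qed.

Let q : R := expR (- (3 / 2)).

Let Ap_ge : q * a <= (1 + q) * fine (mu Ap).
Proof.
apply: (gaussian_tail_ge c_sum c_eigen lambda0 c2 gmu T0 TS mA) => l.
  by rewrite /A /= in_itv /= andbT.
by rewrite /A /= in_itv /= andbT; apply: le_trans; exact: ltW.
Qed.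

Let Bm_ge : q * b <= (1 + q) * fine (mu Bm).
Proof.
have c2' : 0 < \sum_i (- c i) ^+ 2 by rewrite Nc2.
have TS' : T ^+ 2 * lambda <= \sum_i (- c i) ^+ 2 by rewrite Nc2.
apply: (gaussian_tail_ge Nc_sum Nc_eigen lambda0 c2' gmu T0 TS' mB) => l.
  by rewrite /B /= in_itv /= pairingN => ?; lra.
by rewrite pairingN /B /= in_itv /=; move: T0; lra.
Qed.

Let AB : a + b = 1.
Proof.
rewrite -fineD ?fin_num_measure // -measureU //.
  have -> : A `|` B = setT by
    apply/seteqP; split => // l _; rewrite /A /B /= !in_itv /= andbT;
    have [h|h] := leP 0 (G l); [left|right].
  exact: (congr1 fine (probability_setT mu)).
apply/seteqP; split => // l [].
by rewrite /A /B /= !in_itv /= andbT => h1 /(le_lt_trans h1); rewrite ltxx.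
Qed.

(* [step] takes the values [b] on [A] and [- a] on [B]; it has mean zero. *)
Let step (x : profile R n * 'Z_n) : R := \1_A x.1 - a.

Let stepA x : A x.1 -> step x = b.
Proof. by move=> Ax; rewrite /step indicE mem_set // -AB addrC addKr. Qed.

Let stepB x : B x.1 -> step x = - a.
Proof.
rewrite /step indicE /B /= in_itv /= => Bx.
by rewrite memNset ?sub0r // /A /= in_itv /= andbT leNgt Bx.
Qed.

Let AorB l : A l \/ B l.
Proof.
rewrite /A /B /= !in_itv /= andbT.
by have [h|h] := leP 0 (G l); [left|right].
Qed.

Let a_le1 : a <= 1. Proof. by rewrite -AB lerDl ltW. Qed.
Let b_le1 : b <= 1. Proof. by rewrite -AB lerDr ltW. Qed.

Let step_sqr_le1 x : step x ^+ 2 <= 1.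
Proof.
have [/stepA ->|/stepB ->] := AorB x.1; rewrite ?sqrrN expr_le1 //; exact: ltW.
Qed.

Let measurable_step : measurable_fun setT step.
Proof.
by apply: measurable_funB => //; apply: measurableT_comp.
Qed.

Lemma integral_two_indic (A' B' : set (profile R n)) (x y : R) :
    measurable A' -> measurable B' -> 0 <= x -> 0 <= y ->
  (\int[mu]_l (x * \1_A' l + y * \1_B' l)%:E =
   (x * fine (mu A') + y * fine (mu B'))%:E)%E.
Proof.
move=> mA' mB' x0 y0.
under eq_integral do rewrite EFinD !EFinM.
have mI C : measurable C ->
    measurable_fun setT (fun l : profile R n => (\1_C l : R)%:E).
  by move=> mC; apply/measurable_EFinP; exact: measurable_indic.
have I0 C (l : profile R n) : (0 <= (\1_C l : R)%:E)%E by rewrite lee_fin.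
rewrite ge0_integralD //; last 4 first.
- by move=> l _; rewrite mule_ge0 // lee_fin.
- by apply: measurable_funeM; exact: mI.
- by move=> l _; rewrite mule_ge0 // lee_fin.
- by apply: measurable_funeM; exact: mI.
rewrite !ge0_integralZl ?lee_fin //; [|exact: mI..].
by rewrite !integral_indic // !setIT EFinD !EFinM !fineK // fin_num_measure.
Qed.

Let integral_step_sqr :
  (\int[muh]_x (step x ^+ 2)%:E = (a * b)%:E)%E.
Proof.
transitivity (\int[muh]_x (b ^+ 2 * \1_A x.1 + a ^+ 2 * \1_B x.1)%:E)%E.
  apply: eq_integral => x _; congr EFin; rewrite !indicE.
  have [Ax|Bx] := AorB x.1.
    rewrite stepA // mem_set // memNset ?mulr1 ?mulr0 ?addr0 //.
    by move: Ax; rewrite /A /B /= !in_itv /= andbT ltNge => ->.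
  rewrite stepB // sqrrN [x.1 \in B]mem_set // memNset ?mulr1 ?mulr0 ?add0r //.
  by move: Bx; rewrite /A /B /= !in_itv /= andbT leNgt => ->.
rewrite (@ge0_integral_fst _ _ _ _ _ mu kappa
  (fun l => (b ^+ 2 * \1_A l + a ^+ 2 * \1_B l)%:E)).
- rewrite integral_two_indic ?sqr_ge0 //; congr EFin.
  by rewrite -/a -/b -[RHS]mulr1 -AB; ring.
- by apply/measurable_EFinP; apply: measurable_funD;
    apply: measurable_funM => //; exact: measurable_indic.
- by move=> l; rewrite lee_fin addr_ge0 // mulr_ge0 ?sqr_ge0.
Qed.

Let step_L2 : step \in Lfun muh 2%:E.
Proof. by apply: L2_sqr_integrable => //; rewrite integral_step_sqr ltry. Qed.

Let step_L20 : L20 muh step.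
Proof.
split=> // r; rewrite /L2inner.
have mf : measurable_fun setT (fun l : profile R n => (\1_A l - a) * r).
  by apply: measurable_funM => //; apply: measurable_funB => //;
    exact: measurable_indic.
have ic (C : set (profile R n)) : measurable C ->
    mu.-integrable setT (EFin \o (\1_C : profile R n -> R)).
  by move=> mC; exact: integrable_indic.
rewrite (Rintegral_fst mu kappa mf) RintegralZr //; last first.
  rewrite (_ : _ \o _ = (fun l => (\1_A l)%:E - a%:E)%E) //.
  by apply: integrableB => //; [exact: ic|exact: finite_measure_integrable_cst].
rewrite RintegralB //; [|exact: ic|exact: finite_measure_integrable_cst].
have muT : fine (mu setT) = 1 := congr1 fine (probability_setT mu).
rewrite Rintegral_cst // muT mulr1.
by rewrite /Rintegral integral_indic // setIT subrr mul0r.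
Qed.

(** Where paths meet the kernel: if all paths from [x] end with the value [r], then [ph t x] does
    not charge the other values. *)
Let semigroup_step t x r : 0 <= t ->
    (forall w, (cL 0 w, X 0 w) = x -> step (cL t w, X t w) = r) ->
  semigroup ph t step x = r.
Proof.
move=> t0 sr; have mN : measurable [set y | step y != r].
  have -> : [set y | step y != r] = step @^-1` [set~ r].
    by apply/seteqP; split => y /=; [move/eqP|move/eqP].
  rewrite -[X in measurable X]setTI; apply: measurable_step => //.
  exact: measurableC.
rewrite /semigroup /Rintegral (ae_eq_integral (cst r%:E)) //.
- by rewrite integral_cst // prob_kernel mule1.
- exact/measurable_EFinP.
exists [set y | step y != r]; split => //.
- apply: (transition_null rw phP) => // w /sr wr.
  by rewrite /= wr eqxx.
- by move=> y /= h; apply/eqP => yr; apply: h => _ /=; rewrite yr.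
Qed.

Let semigroup_step_Ap t x : 0 <= t -> t < T -> Ap x.1 ->
  semigroup ph t step x = b.
Proof.
move=> t0 tT; rewrite /Ap /= in_itv /= andbT => Tx.
apply: semigroup_step => // w wx; apply: stepA; rewrite /A /= in_itv /= andbT.
have := pairing_displacement n2 rw w t0 c_sum c1;
  rewrite ler_norml => /andP[h _].
have e : cL 0 w = x.1 by rewrite -wx.
by rewrite e in h; move: h Tx tT; lra.
Qed.

Let semigroup_step_Bm t x : 0 <= t -> t < T -> Bm x.1 ->
  semigroup ph t step x = - a.
Proof.
move=> t0 tT; rewrite /Bm /= in_itv /= andbT pairingN => Tx.
apply: semigroup_step => // w wx; apply: stepB; rewrite /B /= in_itv /=.
have := pairing_displacement n2 rw w t0 c_sum c1;
  rewrite ler_norml => /andP[_ h].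
have e : cL 0 w = x.1 by rewrite -wx.
by rewrite e in h; move: h Tx tT; lra.
Qed.

Let measurable_Pstep t : measurable_fun setT (semigroup ph t step).
Proof. exact: measurable_semigroup. Qed.

Let Pstep_L2 t : semigroup ph t step \in Lfun muh 2%:E.
Proof.
apply: L2_sqr_integrable => //.
apply: (@le_lt_trans _ _ (\int[muh]_x 1%:E)%E); last first.
  rewrite integral_cst // [X in (_ * X)%E](_ : _ = 1%E) ?mule1 ?ltry //.
  exact: probability_setT.
apply: ge0_le_integral => //.
- by move=> x _; rewrite lee_fin sqr_ge0.
- by apply/measurable_EFinP; exact: measurable_funX.
move=> x _; apply: (@le_trans _ _ (\int[ph t x]_y (step y ^+ 2)%:E)%E).
  by apply: jensen_sqr => //; exact: prob_kernel.
apply: (@le_trans _ _ (\int[ph t x]_y 1%:E)%E); last first.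
  by rewrite integral_cst // prob_kernel mule1.
apply: ge0_le_integral => //.
- by move=> y _; rewrite lee_fin sqr_ge0.
- by apply/measurable_EFinP; exact: measurable_funX.
by move=> y _; rewrite lee_fin.
Qed.

Let Pstep_sqr_ge t : 0 <= t -> t < T ->
  b ^+ 2 * fine (mu Ap) + a ^+ 2 * fine (mu Bm) <=
  L2inner muh (semigroup ph t step) (semigroup ph t step).
Proof.
move=> t0 tT; rewrite -lee_fin -L2_inner_sqr // -integral_two_indic ?sqr_ge0 //.
have mI : measurable_fun setT
    (fun l : profile R n => (b ^+ 2 * \1_Ap l + a ^+ 2 * \1_Bm l)%:E).
  by apply/measurable_EFinP; apply: measurable_funD;
    apply: measurable_funM => //; exact: measurable_indic.
have I0 l : (0 <= (b ^+ 2 * \1_Ap l + a ^+ 2 * \1_Bm l)%:E)%E.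
  by rewrite lee_fin addr_ge0 // mulr_ge0 ?sqr_ge0.
rewrite -(ge0_integral_fst mu kappa mI I0); apply: ge0_le_integral => //.
- exact: (measurableT_comp mI measurable_fst).
- by apply/measurable_EFinP; exact: measurable_funX.
move=> x _; rewrite lee_fin !indicE.
have [Ax|Ax] := pselect (Ap x.1).
  rewrite semigroup_step_Ap // mem_set // memNset ?mulr1 ?mulr0 ?addr0 //.
  move: Ax; rewrite /Ap /Bm /= !in_itv /= !andbT pairingN => h1 h2.
  by move: T0 h1 h2; lra.
rewrite memNset // mulr0 add0r.
have [Bx|Bx] := pselect (Bm x.1).
  by rewrite semigroup_step_Bm // mem_set // mulr1 sqrrN.
by rewrite memNset // mulr0 sqr_ge0.
Qed.

(** For [t < T] the two tails, where [step] is unchanged, keep at least the fraction [q / (1 + q)]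
    of the squared norm [a * b], which exceeds [e^-2]. *)
Lemma relaxation_time_ge : (T%:E <= relaxation_time muh ph)%E.
Proof.
apply: le_ereal_inf_tmp => _ [t [t0 relax] <-]; rewrite lee_fin leNgt.
apply/negP => tT; have := relax _ step_L20.
rewrite !L2norm_inner // -EFinM lee_fin.
rewrite -(@ler_pXn2r _ 2) ?nnegrE ?mulr_ge0 ?sqrtr_ge0 ?expR_ge0 //.
have Q0 (f : profile R n * 'Z_n -> R) : 0 <= L2inner muh f f.
  by apply: Rintegral_ge0 => x _; rewrite -expr2 sqr_ge0.
rewrite exprMn !sqr_sqrtr //.
have -> : L2inner muh step step = a * b.
  by apply: EFin_inj; rewrite -L2_inner_sqr // integral_step_sqr.
move=> /(le_trans (Pstep_sqr_ge t0 tT)).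
have q0 : 0 < q by exact: expR_gt0.
have ab0 : 0 < a * b by rewrite mulr_gt0.
(* Divided by [q = e^(-3/2)], this is [e^(-1/2) (1 + e^(-3/2)) < 1]; the bounds [2/3] and [2/5],
   from [1 + x <= e^x], give [14/15]. *)
have e2 : expR (-1) ^+ 2 * (1 + q) < q.
  rewrite -expRM_natl mulrDr mulr1 /q -expRD.
  have h1 : expR (2 * -1) = expR (- (3 / 2)) * expR (- (1 / 2)) :> R.
    by rewrite -expRD; congr expR; field.
  have h2 : expR (- (1 / 2)) <= 2 / 3 :> R.
    rewrite expRN -[leRHS]invrK lef_pV2 ?posrE ?expR_gt0 ?invr_gt0 ?divr_gt0 //.
    by apply: le_trans (expR_ge1Dx _); lra.
  have h3 : expR (- (3 / 2)) <= 2 / 5 :> R.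
    rewrite expRN -[leRHS]invrK lef_pV2 ?posrE ?expR_gt0 ?invr_gt0 ?divr_gt0 //.
    by apply: le_trans (expR_ge1Dx _); lra.
  rewrite expRD h1; move: (expR_gt0 (- (3 / 2) : R)) h2 h3.
  move: (expR (- (3 / 2))) (expR (- (1 / 2))) => x y x0 hy hx.
  have -> : x * y + x * y * x = x * (y * (1 + x)) by ring.
  rewrite gtr_pMr //; apply: (@le_lt_trans _ _ (2 / 3 * (1 + x))).
    by rewrite ler_pM2r // addr_gt0.
  by move: hx; lra.
have h1 := ler_wpM2l (sqr_ge0 b) Ap_ge; have h2 := ler_wpM2l (sqr_ge0 a) Bm_ge.
have h3 : q * (a * b) <=
    (1 + q) * (b ^+ 2 * fine (mu Ap) + a ^+ 2 * fine (mu Bm)).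
  have -> : q * (a * b) = b ^+ 2 * (q * a) + a ^+ 2 * (q * b).
    by rewrite -[LHS]mulr1 -AB; ring.
  by apply: le_trans (lerD h1 h2) _; rewrite le_eqVlt; apply/orP; left;
    apply/eqP; ring.
move=> h4; have h5 := ler_wpM2l (ltW (addr_gt0 ltr01 q0)) h4.
have := le_trans h3 h5; rewrite [leRHS]mulrCA [leRHS]mulrA ler_pM2r //.
by rewrite leNgt e2.
Qed.

End relaxation_bound.

Theorem theorem4 (R : realType) :
  (forall (dS dV : measure_display)
      (S : measurableType dS) (V : measurableType dV)
      (mu : probability S R) (kappa : probability V R)
      (p : R -> R.-pker S ~> S)
      (ph : R -> R.-pker (S * V)%type ~> (S * V)%type),
    transition_function p ->
    reversible_measure mu p ->
    strongly_continuous mu p ->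
    transition_function ph ->
    invariant_measure (mu \x kappa)%E ph ->
    strongly_continuous (mu \x kappa)%E ph ->
    second_order_lift mu kappa p ph ->
    (((1 - expR (-1)) / Num.sqrt 2)%:E * sqrte (relaxation_time mu p)
       <= relaxation_time (mu \x kappa) ph)%E) /\
  (forall (n : nat) (mu : probability (profile R n) R)
      (kappa : probability 'Z_n R)
      (d : measure_display) (Om : measurableType d)
      (P : profile R n * 'Z_n -> probability Om R)
      (cL : R -> Om -> profile R n) (X : R -> Om -> 'Z_n)
      (ph : R -> R.-pker (profile R n * 'Z_n)%type
                  ~> (profile R n * 'Z_n)%type),
    (2 <= n)%N ->
    gaussian_profile mu ->
    uniform_Zn kappa ->
    srrw P cL X ->
    transition_of P (fun t w => (cL t w, X t w)) ph ->
    (((1 - expR (-1)) / (2 * pi) * (n%:R `^ (3 / 2)))%:E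
       <= relaxation_time (mu \x kappa) ph)%E).
Proof.
split=> [dS dV S V mu kappa p ph tp rev sc tph invh sch lift|].
  by apply: lift_relaxation_time lift => //; exact: reversible_invariant.
move=> n mu kappa d Om P cL X ph n2 gmu _ rw phP.
have [c [l [c1 c0 ceig /andP[l0 l1] cS]]] := discrete_eigenvector R n2.
have n0 : 0 < n%:R :> R by rewrite ltr0n (leq_trans _ n2).
have S0 : 0 < \sum_i c i ^+ 2 by apply: lt_le_trans cS; rewrite divr_gt0.
have e0 : 0 < 1 - expR (-1) :> R by rewrite subr_gt0 expR_lt1 // ltrN10.
have pi0 : 0 < pi :> R by exact: pi_gt0.
have npow : 0 < n%:R `^ (3 / 2) :> R by exact: powR_gt0.
set T := _ / _ * _.
have T0 : 0 < T by rewrite mulr_gt0 // divr_gt0 // mulr_gt0.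
apply: (relaxation_time_ge kappa n2 gmu rw phP c0 c1 ceig (ltW l0) S0 T0).
(* The chain is [T^2 lambda <= (1 - e^-1)^2 n <= n/2 <= |c|^2]: the factor [4 pi^2 / n^2] cancels
   against the square of [n^(3/2) / (2 pi)]. *)
apply: le_trans cS.
have np2 : (n%:R `^ (3 / 2)) ^+ 2 = n%:R ^+ 3 :> R.
  by rewrite -powR_mulrn ?powR_ge0 // -powRrM divfK // powR_mulrn // ltW.
(* The bound [1 + x <= e^x] is empty at [x = -1]; at [x = -1/3], cubed, it gives [e^-1 >= 8/27], and
   [(19/27)^2 < 1/2]. *)
have e1 : (1 - expR (-1)) ^+ 2 <= 2^-1 :> R.
  have h : 2 / 3 <= expR (- 3^-1) :> R.
    by apply: le_trans (expR_ge1Dx _); lra.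
  have : (2 / 3) ^+ 3 <= expR (-1) :> R.
    apply: (@le_trans _ _ (expR (- 3^-1) ^+ 3)).
      by rewrite ler_pXn2r ?nnegrE ?expR_ge0 // divr_ge0.
    by rewrite -expRM_natl mulrN divff // pnatr_eq0.
  by move: e0 => /ltW; nra.
apply: (@le_trans _ _ (T ^+ 2 * (4 * pi ^+ 2 / n%:R ^+ 2))).
  by rewrite ler_wpM2l ?sqr_ge0.
have -> : T ^+ 2 * (4 * pi ^+ 2 / n%:R ^+ 2) = (1 - expR (-1)) ^+ 2 * n%:R.
  rewrite /T !exprMn np2; move: (pi : R) pi0 => x x0.
  by field; rewrite !gt_eqF.
by rewrite mulrC ler_wpM2l // ltW.
Qed.
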